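(* Let $\phi_1,\phi_2$ be either both in $\tilde{\Phi}_1$ or both in $\tilde{\Psi}_1$, let $\alpha,\beta>0$ be constants with $\alpha+\beta\ge1$, and let $\varphi(x,y)=\alpha\phi_1(x)+\beta\phi_2(y)$. Put $F_1(t)=\phi_1(t^{-1/n})$ and $F_2(t)=\phi_2(t^{-1/n})$ for $t>0$. Let $K,L\in\mathcal{S}_0$. (i) If both $F_1$ and $F_2$ are convex, then $$\alpha\,\phi_1\bigg(\bigg(\frac{|K\widetilde{+}_{\varphi}L|}{|K|}\bigg)^{1/n}\bigg)+\beta\,\phi_2\bigg(\bigg(\frac{|K\widetilde{+}_{\varphi}L|}{|L|}\bigg)^{1/n}\bigg)\le1.$$ If in addition at least one of $F_1$ and $F_2$ is strictly convex, equality holds if and only if $K$ and $L$ are dilates of each other. (ii) If both $F_1$ and $F_2$ are concave, then $$\alpha\,\phi_1\bigg(\bigg(\frac{|K\widetilde{+}_{\varphi}L|}{|K|}\bigg)^{1/n}\bigg)+\beta\,\phi_2\bigg(\bigg(\frac{|K\widetilde{+}_{\varphi}L|}{|L|}\bigg)^{1/n}\bigg)\ge1.$$ If in addition at least one of $F_1$ and $F_2$ is strictly concave, equality holds if and only if $K$ and $L$ are dilates of each other.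
   Context: Fix a positive integer $n$. A star body (about the origin) is a set $K\subset\mathbb{R}^n$ that contains the segment from the origin to each of its points and whose radial function $\rho_K(u)=\max\{\lambda:\lambda u\in K\}$, $u\in S^{n-1}$, is continuous and positive on $S^{n-1}$. $\mathcal{S}_0$ is the set of all star bodies; a star body is uniquely determined by its (continuous positive) radial function and vice versa. $K,L\in\mathcal{S}_0$ are dilates of each other if $L=\lambda K$ for some constant $\lambda>0$. $|K|$ denotes volume. $\tilde{\Phi}_1$ is the set of continuous strictly increasing functions $\phi:[0,\infty)\to[0,\infty)$ with $\phi(0)=0$ and $\phi(1)=1$. $\tilde{\Psi}_1$ is the set of functions $\phi:(0,\infty)\to(0,\infty)$ such that $t\mapsto\phi(1/t)$ belongs to $\tilde{\Phi}_1$ (i.e. extends continuously from $(0,\infty)$ to $[0,\infty)$ as an element of $\tilde{\Phi}_1$). For $\varphi(x,y)=\alpha\phi_1(x)+\beta\phi_2(y)$ with $\phi_1,\phi_2$ both in $\tilde{\Phi}_1$ or both in $\tilde{\Psi}_1$ and $\alpha,\beta>0$, $\alpha+\beta\ge1$, the linear Orlicz $\varphi$-radial addition $K\widetilde{+}_{\varphi}L\in\mathcal{S}_0$ of $K,L\in\mathcal{S}_0$ is the star body whose radial function is uniquely determined by $$1=\alpha\,\phi_1\bigg(\frac{\rho_{K\widetilde{+}_{\varphi}L}(u)}{\rho_K(u)}\bigg)+\beta\,\phi_2\bigg(\frac{\rho_{K\widetilde{+}_{\varphi}L}(u)}{\rho_L(u)}\bigg)\quad\text{for all }u\in S^{n-1}.$$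 *)

(* Defs.v *)
From HB Require Import structures.
From mathcomp Require Import all_boot all_order all_algebra.
From mathcomp Require Import all_classical all_reals all_analysis.

Set Implicit Arguments.
Unset Strict Implicit.
Unset Printing Implicit Defensive.

Import Order.TTheory GRing.Theory Num.Theory.
Import numFieldTopology.Exports numFieldNormedType.Exports.

Local Open Scope classical_set_scope.
Local Open Scope ring_scope.

Section volume.
Context {R : realType}.
Local Open Scope ereal_scope.

(* n-dimensional Lebesgue measure as an iterated product measure, on tuples
   because 'rV[R]_n carries no measurable structure. *)
Fixpoint lebesgue_tuple (n : nat) :
    set (n.-tuple (measurableTypeR R)) -> \bar R :=
  match n with
  | 0 => dirac [tuple]
  | n'.+1 => pushforward (lebesgue_measure \x @lebesgue_tuple n')
      (fun p => [tuple of p.1 :: p.2] : n'.+1.-tuple (measurableTypeR R))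
  end.

Definition volume (n : nat) (A : set 'rV[R]_n) : R :=
  fine (lebesgue_tuple [set t : n.-tuple _ | A (\row_i tnth t i)%R]).

End volume.

Section star_bodies.
Context {R : realType} {n : nat}.
Implicit Types (K L M : set 'rV[R]_n) (u x : 'rV[R]_n).

(* The norm of 'rV[R]_n in the library is the sup norm, so the Euclidean one is
   spelled out here; both induce the topology used for continuity below. *)
Definition unit_sphere : set 'rV[R]_n :=
  [set u | Num.sqrt (\sum_i u 0 i ^+ 2) = 1].

Definition ray K u : set R := [set l | K (l *: u)].

Definition radial K u : R := sup (ray K u).

(* The second condition says that the supremum defining [radial K u] is a
   maximum. *)
Definition star_body K : Prop :=
  [/\ forall x, K x -> forall t : R, 0 <= t <= 1 -> K (t *: x),
      forall u, unit_sphere u ->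
        has_ubound (ray K u) /\ ray K u (radial K u),
      {within unit_sphere, continuous (radial K)} &
      forall u, unit_sphere u -> 0 < radial K u].

Definition dilates K L : Prop :=
  exists2 l : R, 0 < l & L = [set l *: x | x in K].

Definition is_orlicz_radial_add (phi : R -> R -> R) K L M : Prop :=
  star_body M /\
  forall u, unit_sphere u ->
    1 = phi (radial M u / radial K u) (radial M u / radial L u).

(* Definite description: the default [set0] is irrelevant when a unique such
   star body exists. *)
Definition orlicz_radial_add (phi : R -> R -> R) K L : set 'rV[R]_n :=
  xget set0 [set M | is_orlicz_radial_add phi K L M].

End star_bodies.

Section orlicz_functions.
Context {R : realType}.
Implicit Types (phi F : R -> R) (D : set R).

(* Functions on [0, +oo[ and ]0, +oo[ are represented by total functions whose
   values outside the domain are unconstrained. *)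
Definition Phi1 phi : Prop :=
  [/\ forall t, 0 <= t -> 0 <= phi t,
      {within `[0, +oo[, continuous phi},
      {in `[0, +oo[ &, {homo phi : s t / s < t}},
      phi 0 = 0 &
      phi 1 = 1].

Definition Psi1 phi : Prop :=
  (forall t, 0 < t -> 0 < phi t) /\
  exists2 psi, Phi1 psi & forall t, 0 < t -> psi t = phi t^-1.

Definition linear_orlicz (alpha beta : R) phi1 phi2 (x y : R) : R :=
  alpha * phi1 x + beta * phi2 y.

Definition root_conj (n : nat) phi (t : R) : R := phi (t `^ (- n%:R^-1)).

Definition strictly_convex_function D F : Prop :=
  forall t x y, 0 < t < 1 -> D x -> D y -> x != y ->
    F (t * x + (1 - t) * y) < t * F x + (1 - t) * F y.

Definition concave_function D F : Prop :=
  convex_function (D : set R^o) (fun x => - F x).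

Definition strictly_concave_function D F : Prop :=
  strictly_convex_function D (fun x => - F x).

End orlicz_functions.

(* Main.v *)
(** For star bodies [K] and [M], the radial function extends to a function that is
    homogeneous of degree -1 off the origin, and splitting space into thin cones
    on which the ratio [radial K / radial M] is almost constant gives, from the
    scaling of Lebesgue measure alone,
    [volume K = \int_M (radial K x / radial M x) ^+ n dx]; no polar coordinates
    are needed.  Let [M] be the Orlicz sum and [r_K], [r_L] the [n]-th powers of
    the ratios [radial K / radial M], [radial L / radial M], so that
    [alpha * F1 r_K + beta * F2 r_L = 1] pointwise.  Replacing the convex [F1],
    [F2] by their supporting lines at the means [volume K / volume M],
    [volume L / volume M] of [r_K], [r_L] over [M] and integrating over [M] gives
    the inequality.  If equality holds, the sum of the two lines is constant, so
    strict convexity forces [r_K] or [r_L], and then both, to be constant.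
    The concave case is the convex one for [- F1], [- F2]. *)

From HB Require Import structures.
Require Import Defs.
From mathcomp Require Import all_boot all_order all_algebra.
From mathcomp Require Import all_classical all_reals all_analysis.
From mathcomp Require Import measurable_realfun ring lra.
Import Order.TTheory GRing.Theory Num.Theory.
Import numFieldTopology.Exports numFieldNormedType.Exports.
Local Open Scope classical_set_scope.
Local Open Scope ring_scope.

Set Implicit Arguments.
Unset Strict Implicit.
Unset Printing Implicit Defensive.

(** * Lebesgue measure on tuples *)

Section lebesgue_tuple_measure.
Context {R : realType}.
Local Notation RT := (measurableTypeR R).
Local Open Scope ereal_scope.

(** Bundles a bare set function, so that being a measure can be proved by induction as an existence
    statement before any instance is declared. *)
Lemma sigma_finite_measure_of (d : measure_display) (T : measurableType d)
    (f : set T -> \bar R) :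
  f set0 = 0 -> (forall A, 0 <= f A) -> semi_sigma_additive f ->
  sigma_finite setT f ->
  exists m : {sigma_finite_measure set T -> \bar R}, f = m.
Proof.
move=> f0 f_ge0 f_sigma f_fin.
pose fm := isMeasure.Build _ _ _ f f0 f_ge0 f_sigma.
pose mf : {measure set T -> \bar R} := HB.pack f fm.
pose fs := Measure_isSigmaFinite.Build _ _ _ mf f_fin.
pose sf : {sigma_finite_measure set T -> \bar R} := HB.pack f mf fs.
by exists sf.
Qed.

Definition cons_pair (n : nat) (p : RT * n.-tuple RT) : n.+1.-tuple RT :=
  [tuple of p.1 :: p.2].

Lemma measurable_cons_pair (n : nat) :
  measurable_fun [set: RT * n.-tuple RT] (@cons_pair n).
Proof. exact: measurable_cons. Qed.

Lemma lebesgue_tupleS (n : nat) (A : set (n.+1.-tuple RT)) :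
  lebesgue_tuple A =
  (lebesgue_measure \x @lebesgue_tuple R n) (@cons_pair n @^-1` A).
Proof. by []. Qed.

(** The recursion runs over bare set functions; the induction therefore carries a bundled measure
    equal to the previous stage, to which the product measure theory applies. *)
Lemma lebesgue_tuple_is_sigma_finite (n : nat) :
  exists m : {sigma_finite_measure set (n.-tuple RT) -> \bar R},
    @lebesgue_tuple R n = m.
Proof.
elim: n => [|n [m mE]]; first by exists (dirac [tuple]).
have mcons := @measurable_cons_pair n.
pose lm : {sigma_finite_measure set RT -> \bar R} := lebesgue_measure.
pose pm := pushforward (lm \x m) (@cons_pair n).
have pm0 : pm set0 = 0 by apply: measure0.
have pm_ge0 A : 0 <= pm A by apply: measure_ge0.
have pm_sigma : semi_sigma_additive pm.
  exact: (@measure_semi_sigma_additive _ _ _ (pushforward (lm \x m) (@cons_pair n))).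
have pm_fin : sigma_finite setT pm.
  have /sigma_finiteP[F [TF ndF Foo]] := sigma_finiteT lm.
  have /sigma_finiteP[G [TG ndG Goo]] := sigma_finiteT m.
  pose uncons (t : n.+1.-tuple RT) : RT * n.-tuple RT :=
    (thead t, [tuple of behead t]).
  have munc : measurable_fun setT uncons.
    by apply: measurable_fun_pair; [exact: measurable_tnth|exact: measurable_behead].
  have consK p : uncons (cons_pair p) = p.
    case: p => x t; apply: (@f_equal2 _ _ _ pair); first by [].
    exact/val_inj.
  (* Boxes of finite measure exhaust the product; since both sequences increase, the index
     [maxn i j] serves both coordinates. *)
  exists (fun k => uncons @^-1` (F k `*` G k)).
    rewrite -preimage_bigcup; apply/esym/seteqP; split => // t _.
    have [i _ Fi] : (\bigcup_k F k) (uncons t).1 by rewrite -TF.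
    have [j _ Gj] : (\bigcup_k G k) (uncons t).2 by rewrite -TG.
    exists (maxn i j) => //; split.
    - by move: Fi; exact/subsetPset/ndF/leq_maxl.
    - by move: Gj; exact/subsetPset/ndG/leq_maxr.
  move=> k; have [mF Fk] := Foo k; have [mG Gk] := Goo k; split.
    rewrite -[X in measurable X]setTI; apply: munc => //.
    exact: measurableX.
  rewrite /pm /pushforward -comp_preimage (_ : uncons \o _ = id); last exact/funext.
  by rewrite preimage_id product_measure1E// lte_mul_pinfty// ge0_fin_numE.
have [spm pmE] := sigma_finite_measure_of pm0 pm_ge0 pm_sigma pm_fin.
by exists spm; rewrite -pmE; apply/funext => A; rewrite lebesgue_tupleS mE.
Qed.

Let lebesgue_tuple0 (n : nat) : @lebesgue_tuple R n set0 = 0.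
Proof. by have [m ->] := lebesgue_tuple_is_sigma_finite n. Qed.

Let lebesgue_tuple_ge0 (n : nat) A : 0 <= @lebesgue_tuple R n A.
Proof. by have [m ->] := lebesgue_tuple_is_sigma_finite n. Qed.

Let lebesgue_tuple_sigma_additive (n : nat) :
  semi_sigma_additive (@lebesgue_tuple R n).
Proof.
have [m ->] := lebesgue_tuple_is_sigma_finite n.
exact: measure_semi_sigma_additive.
Qed.

HB.instance Definition _ (n : nat) := isMeasure.Build _ _ _
  (@lebesgue_tuple R n) (@lebesgue_tuple0 n) (@lebesgue_tuple_ge0 n)
  (@lebesgue_tuple_sigma_additive n).

Let lebesgue_tuple_sigma_finite (n : nat) :
  sigma_finite setT (@lebesgue_tuple R n).
Proof.
have [m ->] := lebesgue_tuple_is_sigma_finite n.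
exact: sigma_finiteT.
Qed.

HB.instance Definition _ (n : nat) := Measure_isSigmaFinite.Build _ _ _
  (@lebesgue_tuple R n) (@lebesgue_tuple_sigma_finite n).

Lemma lebesgue_tuple_cons_pair (n : nat) (A : set RT) (B : set (n.-tuple RT))
    (C : set (n.+1.-tuple RT)) :
  measurable A -> measurable B ->
  @cons_pair n @^-1` C = A `*` B ->
  lebesgue_tuple C = lebesgue_measure A * lebesgue_tuple B.
Proof.
move=> mA mB CE; rewrite lebesgue_tupleS CE.
exact: product_measure1E.
Qed.

(** The centres are indexed by [nat] rather than ['I_n] so that the induction can pass to the
    shifted sequence. *)
Lemma lebesgue_tuple_cube (n : nat) (c : nat -> R) (r : R) : (0 < r)%R ->
  lebesgue_tuple [set t : n.-tuple RT |
    forall i : 'I_n, ball (c i) r (tnth t i)] = ((r *+ 2) ^+ n)%:E.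
Proof.
move=> r0; elim: n c => [|n IH] c.
  by rewrite /= diracE mem_set// => -[].
rewrite (@lebesgue_tuple_cons_pair _ (ball (c 0%N) r : set R)
    [set t : n.-tuple RT | forall i : 'I_n, ball (c i.+1) r (tnth t i)]).
- rewrite (IH (fun i => c i.+1)) lebesgue_measure_ball ?ltW//.
  by rewrite -EFinM exprS.
- by rewrite ball_itv; exact: measurable_itv.
- have -> : [set t : n.-tuple RT | forall i : 'I_n, ball (c i.+1) r (tnth t i)] =
    \bigcap_(i : 'I_n) ((@tnth n RT ^~ i) @^-1` (ball (c i.+1) r : set R)).
    by apply/seteqP; split => t /= h i; [move=> _; exact: h|exact: (h i)].
  apply: fin_bigcap_measurable => // i _.
  rewrite -[X in measurable X]setTI.
  by apply: measurable_tnth => //; by rewrite ball_itv; exact: measurable_itv.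
- apply/seteqP; split => [[x t]/= h|[x t]/= [h1 h2] i].
    split; first by have := h ord0; rewrite tnth0.
    by move=> i /=; have := h (lift ord0 i); rewrite tnthS.
  case: (unliftP ord0 i) => [j ->|->]; last by rewrite tnth0.
  by rewrite tnthS; exact: h2.
Qed.

(** Both sides are measures that agree on half-open intervals, so uniqueness of Lebesgue measure
    applies. *)
Lemma lebesgue_measure_scale (l : R) (A : set R) : (0 < l)%R ->
  measurable (A : set RT) ->
  lebesgue_measure (A : set RT) =
  l%:E * lebesgue_measure ([set x | A (l * x)%R] : set RT).
Proof.
move=> l0 mA.
have ml : measurable_fun [set: RT] ( *%R l : RT -> RT).
  exact: mulrl_measurable.
pose m' : {measure set RT -> \bar R} := mscale (NngNum (ltW l0))
  (pushforward lebesgue_measure ( *%R l : RT -> RT)).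
transitivity (m' ml (A : set RT)); last by [].
apply: lebesgue_measure_unique => // X [[a b] _ <-]/=.
rewrite /mscale/= /pushforward.
have -> : ( *%R l : RT -> RT) @^-1` `]a, b] = `](a / l)%R, (b / l)%R]%classic.
  by apply/seteqP; split => x /=; rewrite !in_itv/= ltr_pdivrMr// ler_pdivlMr// mulrC.
rewrite !lebesgue_measure_itv/= !lte_fin ltr_pM2r ?invr_gt0//.
case: ifPn => _; last by rewrite mule0.
rewrite -!EFinD -EFinM; congr EFin.
by field; rewrite gt_eqF.
Qed.

Definition scale_tuple (n : nat) (l : R) (t : n.-tuple RT) : n.-tuple RT :=
  [tuple (l * tnth t i)%R | i < n].

Lemma measurable_scale_tuple (n : nat) (l : R) :
  measurable_fun setT (@scale_tuple n l).
Proof.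
apply/measurable_fun_tnthP => i.
rewrite (_ : _ \o _ = (fun t : n.-tuple RT => (l * tnth t i)%R)); last first.
  by apply/funext => t /=; rewrite tnth_mktuple.
apply: (@measurableT_comp _ _ _ _ _ _ ( *%R l : RT -> RT)).
  exact: mulrl_measurable.
exact: measurable_tnth.
Qed.

(** Induction on the dimension: the rescaled pushforward [m'] of the product measure agrees with it
    on rectangles, hence everywhere. *)
Lemma lebesgue_tuple_scale (n : nat) (l : R) (A : set (n.-tuple RT)) :
  (0 < l)%R -> measurable A ->
  lebesgue_tuple A = (l ^+ n)%:E * lebesgue_tuple (@scale_tuple n l @^-1` A).
Proof.
move=> l0; elim: n A => [|n IH] A mA.
  rewrite expr0 mul1e; congr lebesgue_tuple.
  by apply/funext => t /=; rewrite [t]tuple0 [scale_tuple _ _]tuple0.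
pose sp (p : RT * n.-tuple RT) : RT * n.-tuple RT :=
  ((l * p.1)%R, scale_tuple l p.2).
have msp : measurable_fun setT sp.
  apply: measurable_fun_pair.
    have ml : measurable_fun [set: RT] ( *%R l : RT -> RT).
      exact: mulrl_measurable.
    exact: (measurableT_comp ml (@measurable_fst _ _ RT (n.-tuple RT))).
  by apply: measurableT_comp => //; exact: measurable_scale_tuple.
pose m' : {measure set (RT * n.-tuple RT) -> \bar R} :=
  mscale (NngNum (ltW (exprn_gt0 n.+1 l0)))
  (pushforward (lebesgue_measure \x @lebesgue_tuple R n) sp).
have E : sp @^-1` (@cons_pair n @^-1` A) =
    @cons_pair n @^-1` (scale_tuple l @^-1` A).
  apply/funext => -[x t]; rewrite /preimage /mkset; congr A.
  apply: eq_from_tnth => i; rewrite tnth_mktuple.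
  case: (unliftP ord0 i) => [j ->|->]; last by rewrite !tnth0.
  by rewrite !tnthS tnth_mktuple.
rewrite !lebesgue_tupleS -E.
transitivity (m' msp (@cons_pair n @^-1` A)); last exact: erefl.
apply: product_measure_unique.
- move=> B C mB mC; rewrite /m'/= /mscale/= /pushforward.
  rewrite (_ : sp @^-1` _ =
      [set x | B (l * x)%R] `*` (scale_tuple l @^-1` C)); last first.
    by apply/seteqP; split => -[].
  rewrite product_measure1E.
  + rewrite (lebesgue_measure_scale l0 mB) (IH _ mC).
    by rewrite exprS EFinM muleACA.
  + rewrite -[X in measurable X]setTI.
    exact: mulrl_measurable.
  + rewrite -[X in measurable X]setTI.
    exact: measurable_scale_tuple.
- rewrite -[X in measurable X]setTI.
  exact: measurable_cons_pair.
Qed.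

End lebesgue_tuple_measure.

(** * Borel sets of row vectors *)

Section row_measurability.
Context {R : realType} {n : nat}.
Local Notation RT := (measurableTypeR R).
Implicit Types (U : set 'rV[R]_n) (x : 'rV[R]_n).

Definition row_of_tuple (t : n.-tuple RT) : 'rV[R]_n := \row_i tnth t i.

Lemma ball_row x (r : R) (t : n.-tuple RT) : 0 < r ->
  ball x r (row_of_tuple t) <-> forall i, ball (x 0 i) r (tnth t i).
Proof.
move=> r0; split => [[_ h] i|h]; first by have := h 0 i; rewrite mxE.
by split => // i j; rewrite mxE ord1; exact: h.
Qed.

Lemma measurable_ball_row x (r : R) : measurable (row_of_tuple @^-1` ball x r).
Proof.
have [r0|r0] := ltP 0 r; last first.
  rewrite (_ : _ @^-1` _ = set0)//; apply/seteqP; split => // t [] /=.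
  by rewrite ltNge r0.
have -> : row_of_tuple @^-1` ball x r =
    \bigcap_(i : 'I_n) ((@tnth n RT ^~ i) @^-1` (ball (x 0 i) r : set R)).
  apply/seteqP; split => t /=.
    by move=> /ball_row h i _; apply: h.
  by move=> h; apply/ball_row => // i; exact: (h i).
apply: fin_bigcap_measurable => // i _; rewrite -[X in measurable X]setTI.
by apply: measurable_tnth => //; exact: measurable_ball.
Qed.

(** An open set is the union of the balls with rational centre and radius [1 / (k + 1)] that it
    contains, and these are countably many. *)
Lemma open_measurable_row U : open U -> measurable (row_of_tuple @^-1` U).
Proof.
move=> oU.
pose B (p : 'rV[rat]_n * nat) : set 'rV[R]_n :=
  ball (map_mx ratr p.1 : 'rV[R]_n) (p.2.+1%:R^-1).
pose F p : set (n.-tuple RT) :=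
  if `[< B p `<=` U >] then row_of_tuple @^-1` B p else set0.
have -> : row_of_tuple @^-1` U = \bigcup_p F p.
  apply/seteqP; split => t /=; last first.
    by move=> [p _]; rewrite /F; case: asboolP => // BU /BU.
  set x := row_of_tuple t => Ux.
  have /nbhs_ballP[e /= e0 eU] : nbhs x U by exact: open_nbhs_nbhs.
  (* A ball of radius below [e / 2] that contains [x] lies inside [ball x e]. *)
  have [k ke] : exists k : nat, k.+1%:R^-1 < e / 2.
    have := near_infty_natSinv_lt (PosNum (divr_gt0 e0 (ltr0Sn R 1))).
    by move=> [k _ /(_ k (leqnn k))] /= ?; exists k.
  have kp : 0 < k.+1%:R^-1 :> R by rewrite invr_gt0.
  have /choice[q qP] i : exists q : rat, ball (ratr q : R) (k.+1%:R^-1) (x 0 i).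
    have /rat_in_itvoo[q] : x 0 i - k.+1%:R^-1 < x 0 i + k.+1%:R^-1.
      by rewrite ltrBlDr -addrA ltrDl addr_gt0.
    rewrite in_itv/= => qi; exists q.
    by rewrite /ball/= ltr_distl.
  have xB : B (\row_i q i, k) x.
    by split => // i j; rewrite ord1 !mxE; have := qP j; rewrite mxE.
  exists (\row_i q i, k) => //; rewrite /F asboolT//.
  move=> y By; apply: eU; apply: (@le_ball _ _ _ (e / 2 + e / 2)); first by lra.
  apply: ball_triangle.
    by apply: ball_sym; apply: le_ball xB; exact: ltW.
  by apply: le_ball By; exact: ltW.
apply: countable_bigcupT_measurable; first exact: countableP.
move=> p; rewrite /F; case: ifP => // _; exact: measurable_ball_row.
Qed.

Lemma lebesgue_tuple_open_gt0 U : open U -> U !=set0 ->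
  (0 < lebesgue_tuple (row_of_tuple @^-1` U))%E.
Proof.
move=> oU [x Ux].
have /nbhs_ballP[e /= e0 eU] : nbhs x U by exact: open_nbhs_nbhs.
(* Extends the coordinates of [x] to a sequence over [nat], as [lebesgue_tuple_cube] expects, with
   default 0 from index [n] on. *)
pose c k := if insub k is Some i then x 0 i else 0.
have cE (i : 'I_n) : c i = x 0 i by rewrite /c valK.
have ballE : row_of_tuple @^-1` ball x e =
    [set t : n.-tuple RT | forall i : 'I_n, ball (c i) e (tnth t i)].
  apply/seteqP; split => t /=.
    by move=> /ball_row h i; rewrite cE; exact: h.
  by move=> h; apply/ball_row => // i; rewrite -cE.
apply: (@lt_le_trans _ _ (lebesgue_tuple (row_of_tuple @^-1` ball x e))).
  by rewrite ballE lebesgue_tuple_cube// lte_fin exprn_gt0// mulrn_wgt0.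
apply: le_measure; rewrite ?inE.
- exact: measurable_ball_row.
- exact: open_measurable_row.
- by move=> t /eU.
Qed.

Lemma open_continuous_measurable_row U (f : 'rV[R]_n -> R) : open U ->
  {in U, continuous f} ->
  measurable_fun (row_of_tuple @^-1` U) (f \o row_of_tuple).
Proof.
move=> oU cf; apply: (measurability _ (RGenOpens.measurableE R)).
move=> _ [_ [a [b ->]] <-].
rewrite (_ : _ `&` _ = row_of_tuple @^-1` (U `&` f @^-1` `]a, b[))//.
apply: open_measurable_row.
rewrite openE => x [Ux fx].
apply: filterI; first exact: open_nbhs_nbhs.
apply: cf; rewrite ?inE//.
by apply: open_nbhs_nbhs; split => //; exact: interval_open.
Qed.

End row_measurability.

(** * Euclidean norm and unit sphere *)

Section enorm.
Context {R : realType} {n : nat}.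
Implicit Types x : 'rV[R]_n.

Definition enorm x : R := Num.sqrt (\sum_i x 0 i ^+ 2).

Lemma enorm_sphere x : unit_sphere x <-> enorm x = 1.
Proof. by []. Qed.

Lemma enorm_ge0 x : 0 <= enorm x.
Proof. exact: sqrtr_ge0. Qed.

Lemma enormZ (l : R) x : enorm (l *: x) = `|l| * enorm x.
Proof.
rewrite /enorm -sqrtr_sqr -sqrtrM ?sqr_ge0// mulr_sumr; congr Num.sqrt.
by apply: eq_bigr => i _; rewrite mxE exprMn.
Qed.

Lemma enorm0 : enorm 0 = 0.
Proof. by rewrite -(scale0r 0) enormZ normr0 mul0r. Qed.

Lemma le_coord_enorm x i : `|x 0 i| <= enorm x.
Proof.
rewrite /enorm -sqrtr_sqr ler_wsqrtr// (bigD1 i)//= lerDl.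
by apply: sumr_ge0 => j _; exact: sqr_ge0.
Qed.

Lemma enorm_gt0 x : x != 0 -> 0 < enorm x.
Proof.
move=> x0; rewrite lt_neqAle enorm_ge0 andbT eq_sym; apply: contra x0 => /eqP e.
apply/eqP/rowP => i; apply/eqP; rewrite mxE -normr_eq0 eq_le normr_ge0 andbT.
by rewrite -e le_coord_enorm.
Qed.

Lemma enorm_continuous : continuous enorm.
Proof.
have sum_cont (r : seq 'I_n) :
    continuous (fun y : 'rV[R]_n => \sum_(i <- r) y 0 i ^+ 2).
  elim: r => [|i r IH] y.
    rewrite (_ : (fun _ => _) = cst 0); first exact: cst_continuous.
    by apply/funext => z; rewrite big_nil.
  rewrite (_ : (fun _ => _) = (fun z : 'rV[R]_n => z 0 i ^+ 2)
      + (fun z => \sum_(i <- r) z 0 i ^+ 2)); last first.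
    by apply/funext => z; rewrite big_cons.
  apply: continuousD; last exact: IH.
  apply: (@continuous_comp _ _ _ (fun z : 'rV[R]_n => z 0 i) (fun a : R => a ^+ 2)).
    exact: coord_continuous.
  exact: exprn_continuous.
move=> x; apply: (@continuous_comp _ _ _
  (fun x : 'rV[R]_n => \sum_i x 0 i ^+ 2)); first exact: sum_cont.
exact: sqrt_continuous.
Qed.

Lemma unit_sphere_normalize x : x != 0 -> unit_sphere ((enorm x)^-1 *: x).
Proof.
move=> /enorm_gt0 x0; apply/enorm_sphere; rewrite enormZ ger0_norm ?invr_ge0 ?enorm_ge0//.
by rewrite mulVf// gt_eqF.
Qed.

Lemma unit_sphere_neq0 x : unit_sphere x -> x != 0.
Proof.
move=> /enorm_sphere; apply: contra_eq_neq => ->.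
by rewrite enorm0 eq_sym oner_neq0.
Qed.

Lemma compact_unit_sphere : compact (@unit_sphere R n).
Proof.
apply: bounded_closed_compact.
  exists 1; split => // M M1 x /enorm_sphere x1.
  rewrite /Num.norm/= mx_normrE; apply/bigmax_leP; split => [|[i j] _ /=].
    by rewrite (le_trans ler01)// ltW.
  by rewrite ord1 (le_trans (le_coord_enorm _ _))// x1 ltW.
rewrite (_ : unit_sphere = enorm @^-1` [set 1])//.
apply: preimage_closed; first by move=> x _; exact: enorm_continuous.
by apply: accessible_closed_set1; apply: hausdorff_accessible; exact: Rhausdorff.
Qed.

Lemma rowv_neq0 : (0 < n)%N -> exists x : 'rV[R]_n, x != 0.
Proof.
move=> n0; exists (const_mx 1); apply/eqP => /rowP /(_ (Ordinal n0)).
by rewrite !mxE => /eqP; rewrite oner_eq0.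
Qed.

Lemma open_neq0 : open [set x : 'rV[R]_n | x != 0].
Proof.
have -> : [set x : 'rV[R]_n | x != 0] = enorm @^-1` [set r | 0 < r].
  apply/seteqP; split => x /=; first exact: enorm_gt0.
  by apply: contraTneq => ->; rewrite enorm0 ltxx.
apply: open_comp; last exact: open_gt.
by move=> x _; exact: enorm_continuous.
Qed.

End enorm.

(** * Radial functions of star bodies *)

Section star_body_theory.
Context {R : realType} {n : nat}.
Local Notation RT := (measurableTypeR R).
Implicit Types (K L M : set 'rV[R]_n) (x u : 'rV[R]_n).

Lemma sup_eq_max (S : set R) (r : R) : S r -> ubound S r -> sup S = r.
Proof.
move=> Sr ubS; apply/eqP; rewrite eq_le ge_sup//=; last by exists r.
by apply: ub_le_sup => //; exists r.
Qed.

Lemma radial_max K u l : star_body K -> unit_sphere u -> K (l *: u) ->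
  l <= radial K u.
Proof. by case=> _ + _ _ => /[apply] -[ub _] Kl; exact: ub_le_sup. Qed.

(** Rescaling the ray gives homogeneity of degree -1, which reduces questions about nonzero vectors
    to the sphere, the only place where [star_body] gives information. *)
Lemma radial_normalize K x : star_body K -> x != 0 ->
  radial K x = (enorm x)^-1 * radial K ((enorm x)^-1 *: x).
Proof.
move=> starK x0; have nx0 := enorm_gt0 x0.
have Su := unit_sphere_normalize x0.
apply: sup_eq_max.
  have [_ /(_ _ Su)[_]] := starK.
  by rewrite /ray /= scalerA mulrC => + _ _; apply.
move=> l; rewrite /ray/= => Kl; rewrite mulrC ler_pdivlMr//.
by apply: radial_max => //; rewrite scalerA mulfK// gt_eqF.
Qed.

Lemma radial_gt0 K x : star_body K -> x != 0 -> 0 < radial K x.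
Proof.
move=> starK x0; rewrite radial_normalize// mulr_gt0 ?invr_gt0 ?enorm_gt0//.
by have [_ _ _] := starK; apply; exact: unit_sphere_normalize.
Qed.

Lemma radialZ K x l : star_body K -> x != 0 -> 0 < l ->
  radial K (l *: x) = l^-1 * radial K x.
Proof.
move=> starK x0 l0; have nx0 := enorm_gt0 x0.
have lx0 : l *: x != 0 by rewrite scaler_eq0 negb_or gt_eqF.
rewrite [LHS]radial_normalize// [in RHS]radial_normalize//.
rewrite enormZ gtr0_norm// scalerA.
have -> : (l * enorm x)^-1 * l = (enorm x)^-1 by field; rewrite !gt_eqF.
by rewrite invfM mulrA.
Qed.

(** The supremum along a ray is attained, and star-shapedness fills the ray below it. *)
Lemma star_bodyP K x : star_body K -> x != 0 -> K x <-> 1 <= radial K x.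
Proof.
move=> starK x0; have nx0 := enorm_gt0 x0.
have Su := unit_sphere_normalize x0.
rewrite radial_normalize// mulrC ler_pdivlMr// mul1r; split => [Kx|le].
  by apply: radial_max => //; rewrite scalerA divff ?gt_eqF// scale1r.
have [Kst /(_ _ Su)[_ Kr] _ /(_ _ Su) r0] := starK.
move: Kr; rewrite /ray/= => /Kst => /(_ (enorm x / radial K ((enorm x)^-1 *: x))).
rewrite !scalerA divfK ?gt_eqF// divff ?gt_eqF// scale1r; apply.
by rewrite divr_ge0 ?(ltW nx0) ?(ltW r0)//= ler_pdivrMr// mul1r.
Qed.

Lemma star_body0 K : (0 < n)%N -> star_body K -> K 0.
Proof.
move=> /(@rowv_neq0 R)[x x0] starK.
have [Kst /(_ _ (unit_sphere_normalize x0))[_ Kr] _ _] := starK.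
by have := Kst _ Kr 0; rewrite scale0r; apply; rewrite lexx ler01.
Qed.

(** Continuity is given only within the sphere; composing with normalization and multiplying by the
    inverse norm carries it to every nonzero point. *)
Lemma radial_continuous K x : star_body K -> x != 0 ->
  {for x, continuous (radial K)}.
Proof.
move=> starK x0.
have nV : {for x, continuous (fun y : 'rV[R]_n => (enorm y)^-1)}.
  apply: (@continuousV _ _ enorm); last exact: enorm_continuous.
  by apply: lt0r_neq0; exact: enorm_gt0.
have nx : {for x, continuous (fun y : 'rV[R]_n => (enorm y)^-1 *: y)}.
  by apply: (@continuousZ _ _ _ _ id) => //; exact: cvg_id.
have near0 : \forall y \near x, y != 0.
  by apply: open_nbhs_nbhs; split => //; exact: open_neq0.
have rn : (fun y => radial K ((enorm y)^-1 *: y)) @ x -->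
    radial K ((enorm x)^-1 *: x).
  have [_ _ /subspace_continuousP Kc _] := starK.
  apply: cvg_comp (Kc _ (unit_sphere_normalize x0)).
  move=> A /= /nx; apply: filterS2 near0 => y y0 /=; apply.
  exact: unit_sphere_normalize.
rewrite /prop_for /continuous_at radial_normalize//.
apply: cvg_trans (cvgM nV rn); apply: (@near_eq_cvg _ _ (nbhs x)).
near=> y; rewrite /= [RHS]radial_normalize//; near: y; exact: near0.
Unshelve. all: by end_near. Qed.

Lemma radial_sphere_bounds K : (0 < n)%N -> star_body K ->
  exists2 r : R * R, 0 < r.1 &
    forall u, unit_sphere u -> r.1 <= radial K u <= r.2.
Proof.
move=> /(@rowv_neq0 R)[x /unit_sphere_normalize Sx] starK.
have [_ _ Kc K0] := starK.
have S0 : @unit_sphere R n !=set0 by exists ((enorm x)^-1 *: x).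
have [a /set_mem Sa amin] := compact_EVT_min S0 (@compact_unit_sphere R n) Kc.
have [b /set_mem Sb bmax] := compact_EVT_max S0 (@compact_unit_sphere R n) Kc.
exists (radial K a, radial K b) => [|u Su] /=; first exact: K0.
by rewrite amin ?bmax// inE.
Qed.

(** The inverse norms cancel in the ratio, so the extrema on the compact sphere bound it. This [c]
    is where the geometric partition into cones starts. *)
Lemma radial_ratio_lb K M : (0 < n)%N -> star_body K -> star_body M ->
  exists2 c : R, 0 < c & forall x, x != 0 -> c <= radial K x / radial M x.
Proof.
move=> n0 sK sM.
have [a a0 aP] := radial_sphere_bounds n0 sK.
have [b b0 bP] := radial_sphere_bounds n0 sM.
exists (a.1 / b.2) => [|x x0].
  have [x x0] := @rowv_neq0 R n n0.
  have /bP/andP[b1 b2] := unit_sphere_normalize x0.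
  by rewrite divr_gt0// (lt_le_trans b0)// (le_trans b1).
have nx := enorm_gt0 x0; have Su := unit_sphere_normalize x0.
rewrite (radial_normalize sK x0) (radial_normalize sM x0).
rewrite -mulf_div divff ?mul1r ?invr_eq0 ?gt_eqF//.
have /andP[a1 a2] := aP _ Su; have /andP[b1 b2] := bP _ Su.
have r0 := lt_le_trans b0 b1; have b20 := lt_le_trans r0 b2.
by rewrite ler_pM ?(ltW a0) ?invr_ge0 ?(ltW b20)// lef_pV2.
Qed.

Lemma open_radial_lt K (r : R) : star_body K ->
  open [set x | x != 0 /\ radial K x < r].
Proof.
move=> sK; rewrite openE => x [x0 xr].
have := radial_continuous sK x0; rewrite /prop_for/continuous_at.
move=> /(_ [set a | a < r]) /(_ (open_nbhs_nbhs (conj (@open_lt _ _) xr))) h.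
by apply: filterI => //; apply: open_nbhs_nbhs; split => //; exact: open_neq0.
Qed.

Lemma open_radial_gt K (r : R) : star_body K ->
  open [set x | x != 0 /\ r < radial K x].
Proof.
move=> sK; rewrite openE => x [x0 xr].
have := radial_continuous sK x0; rewrite /prop_for/continuous_at.
move=> /(_ [set a | r < a]) /(_ (open_nbhs_nbhs (conj (@open_gt _ _) xr))) h.
by apply: filterI => //; apply: open_nbhs_nbhs; split => //; exact: open_neq0.
Qed.

(** Since the origin belongs to [K], the complement is cut out by [radial K x < 1] among nonzero
    vectors, where the radial function is continuous. *)
Lemma star_body_closed K : (0 < n)%N -> star_body K -> closed K.
Proof.
move=> n0 sK; rewrite -openC.
rewrite (_ : ~` K = [set x | x != 0 /\ radial K x < 1]); first exact: open_radial_lt.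
apply/seteqP; split => x /=.
  move=> nK; have x0 : x != 0.
    by apply/eqP => x0; apply: nK; rewrite x0; exact: star_body0.
  by split => //; rewrite ltNge; apply/negP => /(star_bodyP sK x0).
by move=> [x0]; rewrite ltNge => /negP h /(star_bodyP sK x0).
Qed.

End star_body_theory.

(** * Volume as an integral over another star body *)

Section star_body_volume.
Context {R : realType} {n : nat}.
Local Notation RT := (measurableTypeR R).
Local Notation mu := (@lebesgue_tuple R n).
Implicit Types (A K L M : set 'rV[R]_n) (x u : 'rV[R]_n).

(** The origin, where homogeneity and continuity of radial functions break down, is removed; it is a
    null set by [lebesgue_tuple_origin]. *)
Definition punctured A : set (n.-tuple RT) :=
  row_of_tuple @^-1` (A `&` [set x | x != 0]).

Lemma row_of_tuple_scale (l : R) (t : n.-tuple RT) :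
  row_of_tuple (scale_tuple l t) = l *: row_of_tuple t.
Proof. by apply/rowP => i; rewrite !mxE tnth_mktuple. Qed.

Lemma measurable_star_body K : (0 < n)%N -> star_body K ->
  measurable (row_of_tuple @^-1` K).
Proof.
move=> n0 sK; rewrite -[_ @^-1` _]setCK preimage_setC; apply: measurableC.
by apply: open_measurable_row; rewrite openC; exact: star_body_closed.
Qed.

Lemma measurable_neq0 : measurable (row_of_tuple @^-1` [set x : 'rV[R]_n | x != 0]).
Proof. by apply: open_measurable_row; exact: open_neq0. Qed.

Lemma measurable_origin : measurable (row_of_tuple @^-1` [set (0 : 'rV[R]_n)]).
Proof.
rewrite (_ : _ @^-1` _ = ~` (row_of_tuple @^-1` [set x : 'rV[R]_n | x != 0])).
  by apply: measurableC; exact: measurable_neq0.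
apply/seteqP; split => t /=; first by move=> ->; rewrite eqxx.
by move/negP; rewrite negbK => /eqP.
Qed.

Lemma measurable_punctured K : (0 < n)%N -> star_body K ->
  measurable (punctured K).
Proof.
move=> n0 sK; rewrite /punctured preimage_setI; apply: measurableI.
  exact: measurable_star_body.
exact: measurable_neq0.
Qed.

Lemma lebesgue_tuple_star_body_lty K : (0 < n)%N -> star_body K ->
  (mu (row_of_tuple @^-1` K) < +oo)%E.
Proof.
move=> n0 sK; have [[a b] /= a0 abP] := radial_sphere_bounds n0 sK.
have [x x0] := @rowv_neq0 R n n0.
(* The added 1 lets an open ball contain the points at the maximal distance [b]. *)
have b0 : 0 < b + 1.
  have /abP/andP[ax xb] := unit_sphere_normalize x0.
  by rewrite ltr_wpDl// (le_trans (ltW a0))// (le_trans ax).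
apply: (@le_lt_trans _ _ (mu (row_of_tuple @^-1` ball 0 (b + 1)))).
  apply: le_measure; rewrite ?inE.
  - exact: measurable_star_body.
  - exact: measurable_ball_row.
  - move=> t /= Kt; apply/ball_row => // i; rewrite mxE.
    have [t0|t0] := eqVneq (row_of_tuple t) 0.
      by move/rowP : t0 => /(_ i); rewrite !mxE => ->; exact: ballxx.
    rewrite /ball/= sub0r normrN ltr_pwDr// (_ : tnth t i = row_of_tuple t 0 i).
      rewrite (le_trans (le_coord_enorm _ _))//.
      have St := unit_sphere_normalize t0.
      have /andP[_ h] := abP _ St; apply: le_trans h.
      apply: radial_max => //; rewrite scalerA divff ?scale1r//.
      by rewrite gt_eqF// enorm_gt0.
    by rewrite mxE.
have -> : row_of_tuple @^-1` ball 0 (b + 1) =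
    [set t : n.-tuple RT | forall i : 'I_n, ball 0 (b + 1) (tnth t i)].
  apply/seteqP; split => t /=.
    by move=> /(ball_row _ _ b0) h i; have := h i; rewrite mxE.
  by move=> h; apply/ball_row => // i; have := h i; rewrite mxE.
by rewrite (@lebesgue_tuple_cube R n (fun=> 0))// ltry.
Qed.

Lemma lebesgue_tuple_star_body_gt0 K : (0 < n)%N -> star_body K ->
  (0 < mu (row_of_tuple @^-1` K))%E.
Proof.
move=> n0 sK; have [x x0] := @rowv_neq0 R n n0.
have rx := radial_gt0 sK x0.
apply: (@lt_le_trans _ _ (mu (row_of_tuple @^-1` [set x | x != 0 /\ 1 < radial K x]))).
  apply: lebesgue_tuple_open_gt0; first exact: open_radial_gt.
  (* By homogeneity the radial function takes the value 2 at this point. *)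
  exists ((radial K x / 2) *: x) => /=; split.
    by rewrite scaler_eq0 negb_or x0 andbT gt_eqF// divr_gt0.
  rewrite radialZ// ?divr_gt0// invf_div divfK ?gt_eqF//.
  by rewrite ltr1n.
apply: le_measure; rewrite ?inE.
- by apply: open_measurable_row; exact: open_radial_gt.
- exact: measurable_star_body.
- by move=> t /= [t0 h]; apply/(star_bodyP sK t0); exact: ltW.
Qed.

(* The origin is fixed by dilations, so scaling forces its measure to vanish. *)
Lemma lebesgue_tuple_origin K : (0 < n)%N -> star_body K ->
  mu (row_of_tuple @^-1` [set 0]) = 0.
Proof.
move=> n0 sK.
have m0 := measurable_origin.
have fin0 : mu (row_of_tuple @^-1` [set 0]) \is a fin_num.
  rewrite ge0_fin_numE//; apply: le_lt_trans (lebesgue_tuple_star_body_lty n0 sK).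
  apply: le_measure; rewrite ?inE//; first exact: measurable_star_body.
  by move=> t /= ->; exact: star_body0.
have := @lebesgue_tuple_scale R n 2 _ (ltr0Sn R 1) m0.
rewrite [X in _ = (_ * mu X)%E](_ : _ = row_of_tuple @^-1` [set 0]); last first.
  apply/seteqP; split => t /=; rewrite row_of_tuple_scale.
    by move=> /eqP; rewrite scaler_eq0 pnatr_eq0/= => /eqP.
  by move=> ->; rewrite scaler0.
rewrite -(fineK fin0) -EFinM => -[/eqP].
rewrite -subr_eq0 -{1}[fine _]mul1r -mulrBl mulf_eq0 subr_eq0 => /orP[|/eqP->//].
by rewrite eq_sym gt_eqF// exprn_egt1// ?ltr1n// -lt0n.
Qed.

Lemma lebesgue_tuple_punctured K : (0 < n)%N -> star_body K ->
  mu (punctured K) = mu (row_of_tuple @^-1` K).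
Proof.
move=> n0 sK.
rewrite [in RHS](_ : _ @^-1` _ = punctured K `|` row_of_tuple @^-1` [set 0]).
  rewrite measureU//.
  - by rewrite [X in (_ + X)%E](lebesgue_tuple_origin n0 sK) adde0.
  - exact: measurable_punctured.
  - exact: measurable_origin.
  - by apply/seteqP; split => // t [[_ /= t0] t1]; rewrite t1 eqxx in t0.
apply/seteqP; split => t /=.
  by move=> Kt; have [->|t0] := eqVneq (row_of_tuple t) 0; [right|left].
by move=> [[]//|->]; exact: star_body0.
Qed.

Lemma volumeE K : (0 < n)%N -> star_body K ->
  (volume K)%:E = mu (punctured K).
Proof.
move=> n0 sK; rewrite lebesgue_tuple_punctured// /volume fineK//.
by rewrite ge0_fin_numE// lebesgue_tuple_star_body_lty.
Qed.

Lemma volume_gt0 K : (0 < n)%N -> star_body K -> 0 < volume K.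
Proof.
move=> n0 sK; rewrite -lte_fin volumeE// lebesgue_tuple_punctured//.
exact: lebesgue_tuple_star_body_gt0.
Qed.

Definition radial_ratio K M x : R := radial K x / radial M x.

Lemma radial_ratio_gt0 K M x : star_body K -> star_body M -> x != 0 ->
  0 < radial_ratio K M x.
Proof. by move=> sK sM x0; rewrite divr_gt0 ?radial_gt0. Qed.

Lemma radial_ratioZ K M x (l : R) : star_body K -> star_body M -> x != 0 ->
  0 < l -> radial_ratio K M (l *: x) = radial_ratio K M x.
Proof.
move=> sK sM x0 l0; rewrite /radial_ratio !radialZ// -mulf_div divff ?mul1r//.
by rewrite invr_eq0 gt_eqF.
Qed.

Lemma radial_ratio_continuous K M x : star_body K -> star_body M -> x != 0 ->
  {for x, continuous (radial_ratio K M)}.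
Proof.
move=> sK sM x0; apply: continuousM; first exact: radial_continuous.
apply: (@continuousV _ _ (radial M)); last exact: radial_continuous.
by rewrite gt_eqF// radial_gt0.
Qed.

Lemma measurable_radial_ratio K M : star_body K -> star_body M ->
  measurable_fun (row_of_tuple @^-1` [set x | x != 0])
    (radial_ratio K M \o row_of_tuple).
Proof.
move=> sK sM; apply: open_continuous_measurable_row; first exact: open_neq0.
by move=> x /set_mem x0; exact: radial_ratio_continuous.
Qed.

(** The ratio is homogeneous of degree 0, so off the origin this set is invariant under dilations;
    the half-open range makes consecutive cones disjoint. *)
Definition ratio_cone K M (a b : R) : set 'rV[R]_n :=
  [set x | a <= radial_ratio K M x < b].

Lemma measurable_ratio_cone K L M (a b : R) : (0 < n)%N ->
  star_body K -> star_body L -> star_body M ->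
  measurable (punctured (L `&` ratio_cone K M a b)).
Proof.
move=> n0 sK sL sM.
rewrite (_ : punctured _ = (row_of_tuple @^-1` L) `&`
  ((row_of_tuple @^-1` [set x | x != 0]) `&`
   (radial_ratio K M \o row_of_tuple) @^-1` `[a, b[)); last first.
  by apply/seteqP; split => t /=; rewrite in_itv/=; [move=> [[]]|move=> [? []]].
apply: measurableI; first exact: measurable_star_body.
apply: measurable_radial_ratio => //; exact: measurable_neq0.
Qed.

(** Inside the cone [K] lies in the dilate of [M] by [b], so shrinking by [b^-1] maps its part of
    [K] into the part of [M]. *)
Lemma ratio_cone_le K M (a b : R) : (0 < n)%N ->
  star_body K -> star_body M -> 0 < b ->
  (mu (punctured (K `&` ratio_cone K M a b)) <=
   (b ^+ n)%:E * mu (punctured (M `&` ratio_cone K M a b)))%E.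
Proof.
move=> n0 sK sM b0; set C := ratio_cone K M a b.
have b'0 : 0 < b^-1 by rewrite invr_gt0.
have mMC := @measurable_ratio_cone K M M a b n0 sK sM sM.
rewrite (lebesgue_tuple_scale b'0 mMC) muleA -EFinM -exprMn divff ?gt_eqF//.
rewrite expr1n mul1e; apply: le_measure; rewrite ?inE.
- exact: measurable_ratio_cone.
- by rewrite -[X in measurable X]setTI; exact: measurable_scale_tuple.
move=> t [[/= Kt Ct] t0].
have bt0 : b^-1 *: row_of_tuple t != 0.
  by rewrite scaler_eq0 negb_or gt_eqF.
split; rewrite /= row_of_tuple_scale//; split; last first.
  by rewrite /C /ratio_cone/= radial_ratioZ.
apply/(star_bodyP sM bt0); rewrite radialZ// invrK.
have /(star_bodyP sK t0) K1 := Kt.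
move: Ct => /andP[_]; rewrite /radial_ratio ltr_pdivrMr ?radial_gt0// => /ltW.
exact: le_trans.
Qed.

(** Mirror image of [ratio_cone_le]: dilating by [a] maps the part of [M] into the part of [K]. *)
Lemma ratio_cone_ge K M (a b : R) : (0 < n)%N ->
  star_body K -> star_body M -> 0 < a ->
  ((a ^+ n)%:E * mu (punctured (M `&` ratio_cone K M a b)) <=
   mu (punctured (K `&` ratio_cone K M a b)))%E.
Proof.
move=> n0 sK sM a0; set C := ratio_cone K M a b.
have mKC := @measurable_ratio_cone K K M a b n0 sK sK sM.
rewrite (lebesgue_tuple_scale a0 mKC).
apply: lee_wpmul2l; first by rewrite lee_fin exprn_ge0// ltW.
apply: le_measure; rewrite ?inE.
- exact: measurable_ratio_cone.
- by rewrite -[X in measurable X]setTI; exact: measurable_scale_tuple.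
move=> t [[/= Mt Ct] t0].
have at0 : a *: row_of_tuple t != 0.
  by rewrite scaler_eq0 negb_or gt_eqF.
split; rewrite /= row_of_tuple_scale//; split; last first.
  by rewrite /C /ratio_cone/= radial_ratioZ.
apply/(star_bodyP sK at0); rewrite radialZ// mulrC ler_pdivlMr// mul1r.
have /(star_bodyP sM t0) M1 := Mt.
move: Ct => /andP[+ _]; rewrite /radial_ratio ler_pdivlMr ?radial_gt0//.
by apply: le_trans; rewrite ler_peMr// ltW.
Qed.

Lemma bernoulli_exprn (q : R) k : 1 <= q -> 1 + k%:R * (q - 1) <= q ^+ k.
Proof.
move=> q1; elim: k => [|k IH]; first by rewrite mul0r addr0.
rewrite exprS -natr1 (le_trans _ (ler_wpM2l _ IH)) ?(le_trans ler01)//.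
have : 0 <= k%:R * (q - 1) ^+ 2 by rewrite mulr_ge0// sqr_ge0.
by nra.
Qed.

(** Powers of [q] are unbounded by Bernoulli; the least exponent whose power exceeds [y] is positive
    because [1 <= y], and [k] is its predecessor. *)
Lemma exprn_bracket (q y : R) : 1 < q -> 1 <= y ->
  exists k : nat, q ^+ k <= y < q ^+ k.+1.
Proof.
move=> q1 y1.
have [m ym] : exists m : nat, y < q ^+ m.
  have := archi_boundP (divr_ge0 (le_trans ler01 y1) (ltW (_ : 0 < q - 1))).
  rewrite subr_gt0 => /(_ q1); set m := Num.bound _ => ym; exists m.
  apply: lt_le_trans (bernoulli_exprn m (ltW q1)).
  by move: ym; rewrite ltr_pdivrMr ?subr_gt0// => ym; rewrite ltr_wpDl.
have ex : exists m, y < q ^+ m by exists m.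
case: (ex_minnP ex) => -[|k] yk kmin; first by move: yk; rewrite expr0 ltNge y1.
exists k; rewrite yk andbT leNgt; apply/negP => /kmin.
by rewrite ltnn.
Qed.

(* On the cone where the ratio lies in [[c q^k, c q^(k+1)[], [K] is squeezed
   between the dilates of [M] by [c q^k] and [c q^(k+1)]. *)
Lemma cone_integral_bounds K M (q : R) : (0 < n)%N -> star_body K -> star_body M ->
  1 < q ->
  let I := (\int[mu]_(t in punctured M)
    ((radial_ratio K M (row_of_tuple t)) ^+ n)%:E)%E in
  (I <= (q ^+ n)%:E * mu (punctured K))%E /\
  (mu (punctured K) <= (q ^+ n)%:E * I)%E.
Proof.
move=> n0 sK sM q1 I; have q0 : 0 < q by rewrite (lt_trans ltr01).
have [c c0 cP] := radial_ratio_lb n0 sK sM.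
pose C k := ratio_cone K M (c * q ^+ k) (c * q ^+ k.+1).
have covC L : punctured L = \bigcup_k punctured (L `&` C k).
  apply/seteqP; split => t /=; last first.
    by move=> [k _ [[/= Lt _] t0]].
  move=> [/= Lt t0].
  (* The ratio is at least [c], so after division by [c] it falls between two consecutive powers of
     [q]. *)
  have y1 : 1 <= c^-1 * radial_ratio K M (row_of_tuple t).
    by rewrite mulrC ler_pdivlMr// mul1r; exact: cP.
  have [k /andP[k1 k2]] := exprn_bracket q1 y1.
  exists k => //; split => //; split => //; rewrite /C /ratio_cone/=.
  by rewrite -ler_pdivlMl// k1 -ltr_pdivrMl.
have trivC L : trivIset setT (fun k => punctured (L `&` C k)).
  apply/trivIsetP => i j _ _; wlog ij : i j / (i < j)%N => [H|_].
    rewrite neq_lt => /orP[ij|ji]; first by apply: H => //; rewrite neq_lt ij.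
    by rewrite setIC; apply: H => //; rewrite neq_lt ji.
  apply/seteqP; split => // t [[[_ /andP[_ lt]] _] [[_ /andP[ge _]] _]].
  move: (le_lt_trans ge lt); rewrite ltr_pM2l// ltNge ler_weXn2l//.
  exact: ltW.
have mC L k : star_body L -> measurable (punctured (L `&` C k)).
  by move=> sL; exact: measurable_ratio_cone.
have mh D : measurable D -> D `<=` row_of_tuple @^-1` [set x | x != 0] ->
    measurable_fun D (fun t => ((radial_ratio K M (row_of_tuple t)) ^+ n)%:E).
  move=> mD D0; apply/measurable_EFinP; apply: measurable_funX.
  apply: measurable_funS (measurable_radial_ratio sK sM) => //.
  exact: measurable_neq0.
have sub0 L : punctured L `<=` row_of_tuple @^-1` [set x | x != 0] by move=> t [].
have h0 t : punctured setT t -> (0 <= ((radial_ratio K M (row_of_tuple t)) ^+ n)%:E)%E.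
  by move=> [_ t0]; rewrite lee_fin exprn_ge0// ltW// radial_ratio_gt0.
pose J k := (\int[mu]_(t in punctured (M `&` C k))
    ((radial_ratio K M (row_of_tuple t)) ^+ n)%:E)%E.
have IE : I = (\sum_(0 <= k <oo) J k)%E.
  rewrite /I covC ge0_integral_bigcup//.
  - by move=> k; exact: mC.
  - by rewrite -covC; apply: mh; [exact: measurable_punctured|exact: sub0].
  - by move=> t; rewrite -covC => -[_ t0]; apply: h0.
have KE : mu (punctured K) = (\sum_(0 <= k <oo) mu (punctured (K `&` C k)))%E.
  rewrite {1}covC measure_bigcup//=; last by move=> k _; exact: mC.
  by apply: eq_eseriesl => k; rewrite in_setT.
have cq k : 0 < c * q ^+ k by rewrite mulr_gt0// exprn_gt0.
have J0 k : (0 <= J k)%E.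
  by apply: integral_ge0 => t [_ t0]; apply: h0.
have qn0 : 0 <= q ^+ n by rewrite exprn_ge0// ltW.
(* The two thresholds of a cone differ by [q], hence their [n]-th powers by [q ^+ n], which is the
   loss in both bounds. *)
have cqS k : (c * q ^+ k.+1) ^+ n = q ^+ n * (c * q ^+ k) ^+ n.
  by rewrite -exprMn; congr (_ ^+ _); rewrite exprS mulrCA.
split.
  rewrite IE KE -nneseriesZl//; apply: lee_nneseries => // k _.
  (* On each cone the integrand is at most its upper threshold, while [ratio_cone_ge] bounds the
     part of [K] below by the lower one. *)
  apply: (@le_trans _ _ (((c * q ^+ k.+1) ^+ n)%:E * mu (punctured (M `&` C k)))%E).
    rewrite -integral_cst; last exact: mC.
    apply: ge0_le_integral => //.
    + exact: mC.
    + by move=> t [_ t0]; apply: h0.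
    + by apply: mh; [exact: mC|exact: sub0].
    + move=> t [[_ /andP[h1 h2]] t0]; rewrite lee_fin lerXn2r ?nnegrE ?ltW//.
      exact: radial_ratio_gt0.
  rewrite cqS EFinM -muleA; apply: lee_wpmul2l; first by rewrite lee_fin.
  exact: ratio_cone_ge.
rewrite IE KE -nneseriesZl//; apply: lee_nneseries => // k _.
apply: (le_trans (@ratio_cone_le K M (c * q ^+ k) _ n0 sK sM (cq k.+1))).
rewrite cqS EFinM -muleA; apply: lee_wpmul2l; first by rewrite lee_fin.
rewrite -integral_cst; last exact: mC.
apply: ge0_le_integral => //.
- exact: mC.
- by move=> t _; rewrite lee_fin exprn_ge0// ltW.
- by apply: mh; [exact: mC|exact: sub0].
- move=> t [[_ /andP[h1 h2]] t0]; rewrite lee_fin lerXn2r// nnegrE ltW//.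
  exact: radial_ratio_gt0.
Qed.

Lemma le_of_le_mul_gt1 (x y : R) : 0 <= y ->
  (forall q, 1 < q -> x <= q ^+ n * y) -> x <= y.
Proof.
case: n => [|m] y0 H; first by have := H 2; rewrite expr0 mul1r; apply; rewrite ltr1n.
apply/ler_addgt0Pr => e e0.
(* The number [q] is chosen with [q ^+ n = 1 + e / (y + 1)], which gives [q ^+ n * y <= y + e]; the
   added 1 covers [y = 0]. *)
have e'0 : 0 < e / (y + 1) by rewrite divr_gt0// ltr_wpDl.
pose q := (1 + e / (y + 1)) `^ (m.+1%:R^-1).
have qn : q ^+ m.+1 = 1 + e / (y + 1).
  rewrite -powR_mulrn ?powR_ge0// -powRrM mulVf ?pnatr_eq0// powRr1//.
  by rewrite addr_ge0// ltW.
have q1 : 1 < q.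
  rewrite ltNge; apply/negP => q1.
  have : q ^+ m.+1 <= 1 by rewrite exprn_ile1// powR_ge0.
  by rewrite qn gerDl leNgt e'0.
apply: (le_trans (H _ q1)); rewrite qn mulrDl mul1r lerD2l.
rewrite mulrAC ler_pdivrMr ?ltr_wpDl// ler_wpM2l ?(ltW e0)// lerDl.
exact: ler01.
Qed.

(** Both bounds of [cone_integral_bounds] close up as [q] decreases to 1. This replaces the polar
    coordinate formula for volume. *)
Lemma cone_integral K M : (0 < n)%N -> star_body K -> star_body M ->
  (\int[mu]_(t in punctured M)
    ((radial_ratio K M (row_of_tuple t)) ^+ n)%:E)%E = (volume K)%:E.
Proof.
move=> n0 sK sM; set I := (X in X = _).
have I0 : (0 <= I)%E.
  apply: integral_ge0 => t [_ t0].
  by rewrite lee_fin exprn_ge0// ltW// radial_ratio_gt0.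
have aux q := @cone_integral_bounds K M q n0 sK sM.
have Ifin : I \is a fin_num.
  (* Any fixed [q] shows that the integral is finite. *)
  have [+ _] := aux 2 (ltr1n _ _).
  rewrite ge0_fin_numE// -volumeE// => h; apply: le_lt_trans h _.
  by rewrite -EFinM ltry.
have v0 := ltW (volume_gt0 n0 sK).
rewrite -(fineK Ifin); congr EFin; apply/eqP; rewrite eq_le; apply/andP; split.
  apply: le_of_le_mul_gt1 => // q /aux[+ _].
  by rewrite -/I -volumeE// -(fineK Ifin) -EFinM lee_fin.
apply: le_of_le_mul_gt1; first exact: fine_ge0.
move=> q /aux[_]; by rewrite -/I -volumeE// -(fineK Ifin) -EFinM lee_fin.
Qed.

End star_body_volume.

(** * Linear inequalities between powers of radial ratios, and their equality case *)

Section rigidity.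
Context {R : realType} {n : nat}.
Local Notation RT := (measurableTypeR R).
Local Notation mu := (@lebesgue_tuple R n).
Implicit Types (K L M : set 'rV[R]_n) (x : 'rV[R]_n).

Lemma measurable_ratioX K M : (0 < n)%N -> star_body K -> star_body M ->
  measurable_fun (punctured M)
    (fun t => (radial_ratio K M (row_of_tuple t) ^+ n)%:E).
Proof.
move=> n0 sK sM; apply/measurable_EFinP; apply: measurable_funX.
apply: measurable_funS (measurable_radial_ratio sK sM).
- exact: measurable_neq0.
- by move=> t [].
Qed.

Lemma integrable_ratioX K M : (0 < n)%N -> star_body K -> star_body M ->
  mu.-integrable (punctured M)
    (fun t => (radial_ratio K M (row_of_tuple t) ^+ n)%:E).
Proof.
move=> n0 sK sM; apply/integrableP; split; first exact: measurable_ratioX.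
rewrite (eq_integral (fun t => (radial_ratio K M (row_of_tuple t) ^+ n)%:E)).
  by rewrite cone_integral// ltry.
move=> t /set_mem[_ t0]; rewrite gee0_abs// lee_fin exprn_ge0// ltW//.
exact: radial_ratio_gt0.
Qed.

Lemma radial_ratioxx K x : star_body K -> x != 0 -> radial_ratio K K x = 1.
Proof. by move=> sK x0; rewrite /radial_ratio divff// gt_eqF// radial_gt0. Qed.

Lemma ratioX_continuous K M x : star_body K -> star_body M -> x != 0 ->
  {for x, continuous (fun y => radial_ratio K M y ^+ n)}.
Proof.
move=> sK sM x0.
apply: (@continuous_comp _ _ _ (radial_ratio K M) (fun r : R => r ^+ n)).
  exact: radial_ratio_continuous.
exact: exprn_continuous.
Qed.

(* By [cone_integral] the difference of the two sides has zero integral over [M],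
   so it vanishes a.e., hence everywhere by continuity and homogeneity. *)
Lemma ratioX_rigidity K L M (a b c : R) : (0 < n)%N ->
  star_body K -> star_body L -> star_body M ->
  (forall x, x != 0 ->
    a * radial_ratio K M x ^+ n + b * radial_ratio L M x ^+ n <= c) ->
  a * volume K + b * volume L = c * volume M ->
  forall x, x != 0 ->
    a * radial_ratio K M x ^+ n + b * radial_ratio L M x ^+ n = c.
Proof.
move=> n0 sK sL sM le_c vol_eq x x0.
pose f y := a * radial_ratio K M y ^+ n + b * radial_ratio L M y ^+ n.
apply/eqP; rewrite eq_le le_c//= leNgt; apply/negP => fx.
(* The constant [c] enters [g] as [c] times [e M], which is 1 off the origin, so all three terms
   integrate by [cone_integral]. *)
pose e K t : \bar R := (radial_ratio K M (row_of_tuple t) ^+ n)%:E.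
pose g t := (a%:E * e K t + b%:E * e L t + (- c)%:E * e M t)%E.
have ie K' : star_body K' -> mu.-integrable (punctured M) (e K').
  by move=> sK'; exact: integrable_ratioX.
have mM := measurable_punctured n0 sM.
have iK := integrableZl mM a (ie K sK).
have iL := integrableZl mM b (ie L sL).
have iM := integrableZl mM (- c) (ie M sM).
have iKL := integrableD mM iK iL.
have ig : mu.-integrable (punctured M) g := integrableD mM iKL iM.
have gE t : punctured M t -> g t = (f (row_of_tuple t) - c)%:E.
  move=> [_ t0]; rewrite /g /e (radial_ratioxx sM t0) expr1n mule1.
  by rewrite -!EFinM -!EFinD.
have intg : (\int[mu]_(t in punctured M) g t = 0)%E.
  rewrite (integralD mM iKL iM) (integralD mM iK iL).
  rewrite !integralZl ?ie// !cone_integral// -!EFinM -!EFinD vol_eq mulNr subrr.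
  by [].
have /(ae_eq_integral_abs mu mM (measurable_int mu ig)) :
    (\int[mu]_(t in punctured M) `|g t| = 0)%E.
  rewrite (eq_integral (fun t => (- 1)%:E * g t)%E).
    by rewrite (integralZl mM ig) intg mule0.
  move=> t /set_mem Mt; rewrite lee0_abs ?EFinN ?mulN1e// gE//.
  by rewrite lee_fin subr_le0; apply: le_c; case: Mt.
move=> [N [mN N0 gN]].
(* The points in the interior of [M] with strict inequality form an open set; a dilate of [x] lies
   in it, so its measure is positive, although it is contained in the null set [N]. *)
pose U : set 'rV[R]_n :=
  [set y | y != 0 /\ 1 < radial M y] `&` [set y | y != 0 /\ f y < c].
have oU : open U.
  apply: openI; first exact: open_radial_gt.
  rewrite openE => y [y0 fy].
  have cf : {for y, continuous f}.
    by apply: continuousD; apply: continuousM;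
      [exact: cst_continuous|exact: ratioX_continuous
      |exact: cst_continuous|exact: ratioX_continuous].
  apply: filterI; first by apply: open_nbhs_nbhs; split => //; exact: open_neq0.
  by apply: (cf [set r | r < c]); apply: open_nbhs_nbhs; split => //; exact: open_lt.
have rx := radial_gt0 sM x0.
have U0 : U !=set0.
  have l0 : 0 < radial M x / 2 by rewrite divr_gt0.
  have lx : (radial M x / 2) *: x != 0.
    by rewrite scaler_eq0 negb_or x0 andbT gt_eqF.
  exists ((radial M x / 2) *: x); split; split => //.
    by rewrite /= radialZ// invf_div divfK ?gt_eqF// ltr1n.
  by rewrite /= /f !radial_ratioZ.
have := lebesgue_tuple_open_gt0 oU U0; rewrite ltNge => /negP; apply.
rewrite -N0; apply: le_measure; rewrite ?inE//; first exact: open_measurable_row.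
move=> t [[t0 Mt] [_ ft]]; apply: gN => /= h.
have Pt : punctured M t.
  by split => //=; apply/(star_bodyP sM t0); exact: ltW.
move: (h Pt); rewrite gE// => -[/eqP]; rewrite subr_eq0 => /eqP fc.
by move: ft; rewrite /= fc ltxx.
Qed.

End rigidity.

(** * Jensen's inequality by supporting lines *)

Section supporting_line.
Context {R : realType}.
Implicit Types (F : R -> R).

(** Convexity at the weight [(t - t0) / (t - s)], with denominators cleared. *)
Lemma convex_three_points F (s t0 t : R) : convex_function (`]0, +oo[ : set R^o) F ->
  0 < s -> s < t0 -> t0 < t ->
  (t - s) * F t0 <= (t - t0) * F s + (t0 - s) * F t.
Proof.
move=> cF s0 st0 t0t; have ts : 0 < t - s by lra.
have l0 : 0 <= (t - t0) / (t - s) by apply: divr_ge0; lra.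
have l1 : (t - t0) / (t - s) <= 1 by rewrite ler_pdivrMr// mul1r; lra.
pose l : {i01 R} := Itv01 l0 l1.
have sD : (s : R^o) \in (`]0, +oo[%classic : set R^o) by rewrite inE/= in_itv/= s0.
have tD : (t : R^o) \in (`]0, +oo[%classic : set R^o).
  by rewrite inE/= in_itv/= andbT; lra.
have : F ((t - t0) / (t - s) * s + (1 - (t - t0) / (t - s)) * t) <=
    (t - t0) / (t - s) * F s + (1 - (t - t0) / (t - s)) * F t.
  exact: cF l _ _ sD tD.
have -> : (t - t0) / (t - s) * s + (1 - (t - t0) / (t - s)) * t = t0 :> R.
  by field; rewrite gt_eqF.
rewrite -(ler_pM2l ts) => /le_trans; apply.
rewrite le_eqVlt; apply/orP; left; apply/eqP.
by field; rewrite gt_eqF.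
Qed.

(** The slope is the supremum of the chord slopes to the left of [t0]; it is finite because each of
    them is at most every chord slope to the right. *)
Lemma convex_supporting_line F (t0 : R) : convex_function (`]0, +oo[ : set R^o) F ->
  0 < t0 -> exists c, forall t, 0 < t -> F t0 + c * (t - t0) <= F t.
Proof.
move=> cF t00.
pose S : set R := [set (F t0 - F s) / (t0 - s) | s in `]0, t0[].
have S0 : S !=set0.
  exists ((F t0 - F (t0 / 2)) / (t0 - t0 / 2)); exists (t0 / 2) => //=.
  by rewrite in_itv/=; lra.
have slope t : t0 < t -> ubound S ((F t - F t0) / (t - t0)).
  move=> t0t r [s /=]; rewrite in_itv/= => /andP[s0 st0] <-.
  have := convex_three_points cF s0 st0 t0t.
  rewrite ler_pdivrMr ?subr_gt0// mulrAC ler_pdivlMr ?subr_gt0//.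
  by nra.
have hubS : has_ubound S.
  by exists ((F (t0 + 1) - F t0) / (t0 + 1 - t0)); apply: slope; lra.
exists (sup S) => t t_gt0.
case: (ltgtP t t0) => [tt0|t0t|->]; last by lra.
- have : (F t0 - F t) / (t0 - t) <= sup S.
    by apply: ub_le_sup => //; exists t => //=; rewrite in_itv/= t_gt0.
  by rewrite ler_pdivrMr ?subr_gt0//; nra.
- have : sup S <= (F t - F t0) / (t - t0) by apply: ge_sup => //; exact: slope.
  by rewrite ler_pdivlMr ?subr_gt0//; nra.
Qed.

(** If the line met the graph again at [t], strict convexity would put the graph below the line at
    the midpoint of [t] and [t0]. *)
Lemma strictly_convex_supporting_line F (t0 c : R) :
  strictly_convex_function `]0, +oo[ F -> 0 < t0 ->
  (forall t, 0 < t -> F t0 + c * (t - t0) <= F t) ->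
  forall t, 0 < t -> t != t0 -> F t0 + c * (t - t0) < F t.
Proof.
move=> scF t00 supp t t_gt0 tt0.
have half : 0 < (2^-1 : R) < 1 by apply/andP; split; lra.
have tD : (`]0, +oo[%classic : set R) t by rewrite /= in_itv/= t_gt0.
have t0D : (`]0, +oo[%classic : set R) t0 by rewrite /= in_itv/= t00.
have := scF _ _ _ half tD t0D tt0.
have := supp (2^-1 * t + (1 - 2^-1) * t0) ltac:(lra).
by lra.
Qed.

End supporting_line.

Section jensen.
Context {R : realType} {n : nat}.
Implicit Types (K L M : set 'rV[R]_n) (x : 'rV[R]_n).

(** Only the supporting lines are integrated, never [G1] or [G2]: their sum, recentred as [s], has
    mean zero over [M], so by [ratioX_rigidity] it vanishes as soon as it is nowhere positive. Both
    claims follow from this. *)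
Lemma jensen_star_bodies K L M (G1 G2 : R -> R) (alpha beta C : R) :
  (0 < n)%N -> star_body K -> star_body L -> star_body M ->
  0 < alpha -> 0 < beta ->
  convex_function (`]0, +oo[ : set R^o) G1 ->
  convex_function (`]0, +oo[ : set R^o) G2 ->
  (forall x, x != 0 -> alpha * G1 (radial_ratio K M x ^+ n)
                       + beta * G2 (radial_ratio L M x ^+ n) = C) ->
  let t1 := volume K / volume M in
  let t2 := volume L / volume M in
  alpha * G1 t1 + beta * G2 t2 <= C /\
  (alpha * G1 t1 + beta * G2 t2 = C ->
   strictly_convex_function `]0, +oo[ G1 ->
   forall x, x != 0 -> radial_ratio K M x ^+ n = t1).
Proof.
move=> n0 sK sL sM a0 b0 cG1 cG2 GC t1 t2.
have vM := volume_gt0 n0 sM.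
have t10 : 0 < t1 by rewrite divr_gt0// volume_gt0.
have t20 : 0 < t2 by rewrite divr_gt0// volume_gt0.
have [c1 supp1] := convex_supporting_line cG1 t10.
have [c2 supp2] := convex_supporting_line cG2 t20.
pose a := alpha * c1; pose b := beta * c2.
pose s x := a * radial_ratio K M x ^+ n + b * radial_ratio L M x ^+ n
            - (a * t1 + b * t2).
have le_s x : x != 0 -> alpha * G1 t1 + beta * G2 t2 + s x <= C.
  move=> x0; rewrite -(GC x x0).
  have := supp1 _ (exprn_gt0 n (radial_ratio_gt0 sK sM x0)).
  have := supp2 _ (exprn_gt0 n (radial_ratio_gt0 sL sM x0)).
  rewrite -(ler_pM2l b0) => h2; rewrite -(ler_pM2l a0) => h1.
  by move: (lerD h1 h2); rewrite /s /a /b; nra.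
have vol : a * volume K + b * volume L = (a * t1 + b * t2) * volume M.
  by rewrite mulrDl /t1 /t2 -!mulrA !mulVf ?gt_eqF// !mulr1.
have s_eq0 : (forall x, x != 0 -> s x <= 0) -> forall x, x != 0 -> s x = 0.
  move=> s_le0 x x0; apply/eqP; rewrite subr_eq0; apply/eqP.
  apply: ratioX_rigidity => // y y0.
  by rewrite -subr_le0; exact: s_le0.
split.
  (* If the bound failed, [le_s] would make [s] negative everywhere, against its vanishing. *)
  rewrite leNgt; apply/negP => gtC; have [x x0] := @rowv_neq0 R n n0.
  have /(_ x x0) sx : forall x, x != 0 -> s x = 0.
    by apply: s_eq0 => y /le_s; lra.
  by have := le_s x x0; rewrite sx; lra.
move=> eqC scG1 x x0; apply/eqP; apply/negPn/negP => xt1.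
(* Under equality [le_s] reads [s <= 0]. A ratio power other than [t1] would lie strictly above its
   supporting line and make [le_s] strict at [x], where [s] is 0. *)
have sx : s x = 0 by apply: s_eq0 => // y /le_s; lra.
have := strictly_convex_supporting_line scG1 t10 supp1
  (exprn_gt0 n (radial_ratio_gt0 sK sM x0)) xt1.
have := supp2 _ (exprn_gt0 n (radial_ratio_gt0 sL sM x0)).
rewrite -(ler_pM2l b0) => h2; rewrite -(ltr_pM2l a0) => h1.
by move: (ltr_leD h1 h2) sx (GC x x0) eqC; rewrite /s /a /b; nra.
Qed.

End jensen.

(** * Existence of the Orlicz radial sum *)

Section star_body_of_radial.
Context {R : realType} {n : nat}.
Implicit Types (x u : 'rV[R]_n).

(** Recovers a star body from its radial function on the sphere; the implication places the origin,
    which has no direction, in the set. *)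
Definition star_of_radial (rho : 'rV[R]_n -> R) : set 'rV[R]_n :=
  [set x | x != 0 -> enorm x <= rho ((enorm x)^-1 *: x)].

Lemma normalizeZ x (l : R) : x != 0 -> 0 < l ->
  (enorm (l *: x))^-1 *: (l *: x) = (enorm x)^-1 *: x.
Proof.
move=> x0 l0; rewrite enormZ gtr0_norm// scalerA; congr (_ *: _).
by field; rewrite !gt_eqF// enorm_gt0.
Qed.

Lemma radial_star_of_radial (rho : 'rV[R]_n -> R) u :
  (forall v, unit_sphere v -> 0 < rho v) -> unit_sphere u ->
  has_ubound (ray (star_of_radial rho) u) /\
  ray (star_of_radial rho) u (rho u) /\
  radial (star_of_radial rho) u = rho u.
Proof.
move=> rho0 Su; have u0 := unit_sphere_neq0 Su; have ru := rho0 u Su.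
have nu : enorm u = 1 by [].
have norm_u (l : R) : 0 < l -> (enorm (l *: u))^-1 *: (l *: u) = u.
  by move=> l0; rewrite normalizeZ// nu invr1 scale1r.
have mem : ray (star_of_radial rho) u (rho u).
  by move=> _; rewrite norm_u// enormZ nu mulr1 gtr0_norm.
have ub : ubound (ray (star_of_radial rho) u) (rho u).
  move=> l Ml; have [l0|l0] := leP l 0; first exact: le_trans (ltW ru).
  have lu0 : l *: u != 0 by rewrite scaler_eq0 negb_or gt_eqF.
  by have := Ml lu0; rewrite norm_u// enormZ nu mulr1 gtr0_norm.
by split; [exists (rho u)|split => //; exact: sup_eq_max].
Qed.

Lemma star_body_star_of_radial (rho : 'rV[R]_n -> R) :
  {within unit_sphere, continuous rho} ->
  (forall v, unit_sphere v -> 0 < rho v) -> star_body (star_of_radial rho).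
Proof.
move=> crho rho0; split.
- move=> x Mx t /andP[t0 t1] tx0; move: t0; rewrite le_eqVlt => /orP[/eqP t0|t0].
    by move: tx0; rewrite -t0 scale0r eqxx.
  have x0 : x != 0 by move: tx0; rewrite scaler_eq0 negb_or => /andP[].
  rewrite normalizeZ// enormZ gtr0_norm//; apply: le_trans (Mx x0).
  by rewrite ler_piMl// enorm_ge0.
- move=> u Su; have [ub [mem ->]] := radial_star_of_radial rho0 Su.
  by split.
- have E : {in unit_sphere, rho =1 radial (star_of_radial rho)}.
    by move=> u /set_mem Su; have [_ [_ ->]] := radial_star_of_radial rho0 Su.
  exact: subspace_eq_continuous E crho.
- by move=> u Su; have [_ [_ ->]] := radial_star_of_radial rho0 Su; exact: rho0.
Qed.

End star_body_of_radial.

Section orlicz_equation.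
Context {R : realType}.
Variables (psi1 psi2 : R -> R) (alpha beta : R).
Hypotheses (P1 : Phi1 psi1) (P2 : Phi1 psi2) (alpha0 : 0 < alpha)
  (beta0 : 0 < beta) (ab1 : 1 <= alpha + beta).

(* Extends [psi] from [0, +oo[ to a function continuous on the whole line. *)
Definition clamp (psi : R -> R) (t : R) : R := psi (Num.max t 0).

Lemma clampE psi t : 0 <= t -> clamp psi t = psi t.
Proof. by move=> t0; rewrite /clamp max_l. Qed.

Lemma clamp_continuous psi : Phi1 psi -> continuous (clamp psi).
Proof.
move=> [_ /subspace_continuousP c _ _ _] x.
have m0 z : (`[0, +oo[%classic : set R) (Num.max z 0).
  by rewrite /= in_itv/= andbT le_max lexx orbT.
apply: (@cvg_comp _ _ _ (fun t : R => Num.max t 0) psi _ _ _ _ (c _ (m0 x))) => A.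
have cm : {for x, continuous (fun t : R => Num.max t 0)}.
  by apply: continuous_max; [exact: cvg_id|exact: cst_continuous].
move=> /cm hA; apply: (@filterS _ (nbhs x) _ _ _ _ hA) => y h.
exact: (h (m0 y)).
Qed.

Lemma cvg_clamp_sum (T : Type) (F : set_system T) (FF : Filter F)
    (x y : T -> R) (x0 y0 : R) : x @ F --> x0 -> y @ F --> y0 ->
  (fun t => alpha * clamp psi1 (x t) + beta * clamp psi2 (y t)) @ F -->
  alpha * clamp psi1 x0 + beta * clamp psi2 y0.
Proof.
move=> cx cy; apply: cvgD; apply: cvgM; try exact: cvg_cst.
  by apply: continuous_cvg => //; exact: clamp_continuous.
by apply: continuous_cvg => //; exact: clamp_continuous.
Qed.

Definition orlicz_eq (a b s : R) : R :=
  alpha * psi1 (s * a) + beta * psi2 (s * b).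

Lemma Phi1_lt psi (s t : R) : Phi1 psi -> 0 <= s -> s < t -> psi s < psi t.
Proof.
move=> [_ _ h _ _] s0 st; apply: h => //; rewrite in_itv/= andbT//.
by rewrite (le_trans s0)// ltW.
Qed.

Lemma orlicz_eq_lt (a b s t : R) : 0 < a -> 0 < b -> 0 <= s -> s < t ->
  orlicz_eq a b s < orlicz_eq a b t.
Proof.
move=> a0 b0 s0 st; apply: ltrD; rewrite ltr_pM2l//; apply: Phi1_lt => //.
- by rewrite mulr_ge0// ltW.
- by rewrite ltr_pM2r.
- by rewrite mulr_ge0// ltW.
- by rewrite ltr_pM2r.
Qed.

Lemma orlicz_eq_clamp (a b s : R) : 0 < a -> 0 < b -> 0 <= s ->
  orlicz_eq a b s = alpha * clamp psi1 (s * a) + beta * clamp psi2 (s * b).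
Proof. by move=> a0 b0 s0; rewrite !clampE// mulr_ge0// ltW. Qed.

(** Intermediate value theorem between 0, where the left side vanishes, and [a^-1 + b^-1], where
    both arguments exceed 1 and the left side is at least [alpha + beta]. *)
Lemma orlicz_eq_root (a b : R) : 0 < a -> 0 < b ->
  exists2 s, 0 < s & orlicz_eq a b s = 1.
Proof.
move=> a0 b0; pose f s := alpha * clamp psi1 (s * a) + beta * clamp psi2 (s * b).
have cf : continuous f.
  move=> s; apply: cvg_clamp_sum.
    by apply: cvgM; [exact: cvg_id|exact: cvg_cst].
  by apply: cvgM; [exact: cvg_id|exact: cvg_cst].
pose m := a^-1 + b^-1.
have a'0 : 0 < a^-1 by rewrite invr_gt0.
have b'0 : 0 < b^-1 by rewrite invr_gt0.
have m0 : 0 < m by rewrite addr_gt0.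
have [z1 e1] : psi1 0 = 0 /\ psi1 1 = 1 by case: P1.
have [z2 e2] : psi2 0 = 0 /\ psi2 1 = 1 by case: P2.
have f0 : f 0 = 0 by rewrite /f !mul0r !clampE// z1 z2 !mulr0 addr0.
have fm : 1 <= f m.
  rewrite /f -orlicz_eq_clamp ?(ltW m0)//; apply: (le_trans ab1).
  have ma : 1 < m * a by rewrite mulrDl mulVf ?gt_eqF// ltrDl mulr_gt0.
  have mb : 1 < m * b.
    by rewrite mulrDl addrC mulVf ?gt_eqF// ltrDl mulr_gt0.
  have := Phi1_lt P1 ler01 ma; have := Phi1_lt P2 ler01 mb; rewrite e1 e2.
  by move=> h2 h1; apply: ltW; apply: ltrD; rewrite ltr_pMr.
have [|s] := @IVT _ f 0 m 1 (ltW m0) (continuous_subspaceT cf).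
  by rewrite f0 ge_min ler01/= le_max fm orbT.
rewrite in_itv/= => /andP[s0 sm] fs.
have s_gt0 : 0 < s.
  rewrite lt_neqAle s0 andbT; apply/eqP => s0'.
  by move: fs; rewrite -s0' f0 => /eqP; rewrite eq_sym oner_eq0.
by exists s => //; rewrite orlicz_eq_clamp.
Qed.

(** The root depends continuously on the coefficients: the strict inequalities at [s0 - d] and
    [s0 + d] persist for nearby coefficients, and monotonicity traps the root between the two. *)
Lemma orlicz_root_cvg (T : Type) (F : set_system T) (FF : Filter F)
    (a b s : T -> R) (a0 b0 s0 : R) :
  0 < a0 -> 0 < b0 -> 0 < s0 -> orlicz_eq a0 b0 s0 = 1 ->
  a @ F --> a0 -> b @ F --> b0 ->
  (\forall t \near F, 0 < s t /\ orlicz_eq (a t) (b t) (s t) = 1) ->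
  s @ F --> s0.
Proof.
move=> a0p b0p s0p eq0 ca cb ns; apply/cvgrPdist_lt => e e0.
(* Being below [s0] keeps [s0 - d] positive, where the equation is monotone. *)
pose d := Num.min (e / 2) (s0 / 2).
have d0 : 0 < d by rewrite lt_min !divr_gt0.
have de : d < e by rewrite gt_min; apply/orP; left; lra.
have ds : d < s0 by rewrite gt_min; apply/orP; right; lra.
have cW r :
    (fun t => alpha * clamp psi1 (r * a t) + beta * clamp psi2 (r * b t)) @ F -->
    alpha * clamp psi1 (r * a0) + beta * clamp psi2 (r * b0).
  by apply: cvg_clamp_sum; apply: cvgM => //; exact: cvg_cst.
have lo : alpha * clamp psi1 ((s0 - d) * a0) + beta * clamp psi2 ((s0 - d) * b0) < 1.
  by rewrite -eq0 -orlicz_eq_clamp//; [apply: orlicz_eq_lt => //|]; lra.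
have hi : 1 < alpha * clamp psi1 ((s0 + d) * a0) + beta * clamp psi2 ((s0 + d) * b0).
  by rewrite -eq0 -orlicz_eq_clamp//; [apply: orlicz_eq_lt => //|]; lra.
near=> t.
have [st et] : 0 < s t /\ orlicz_eq (a t) (b t) (s t) = 1 by near: t.
have at0 : 0 < a t by near: t; exact: cvgr_gt ca _ a0p.
have bt0 : 0 < b t by near: t; exact: cvgr_gt cb _ b0p.
have lot : alpha * clamp psi1 ((s0 - d) * a t) + beta * clamp psi2 ((s0 - d) * b t) < 1.
  by near: t; exact: cvgr_lt (cW _) _ lo.
have hit : 1 < alpha * clamp psi1 ((s0 + d) * a t) + beta * clamp psi2 ((s0 + d) * b t).
  by near: t; exact: cvgr_gt (cW _) _ hi.
have s_lo : s0 - d < s t.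
  rewrite ltNge; apply/negP; rewrite le_eqVlt => /orP[/eqP E|lt].
    by move: lot; rewrite -E -orlicz_eq_clamp ?(ltW st)// et ltxx.
  have := orlicz_eq_lt at0 bt0 (ltW st) lt; rewrite et orlicz_eq_clamp//; last by lra.
  by move: lot => /lt_trans h /h; rewrite ltxx.
have s_hi : s t < s0 + d.
  rewrite ltNge; apply/negP; rewrite le_eqVlt => /orP[/eqP E|lt].
    by move: hit; rewrite E -orlicz_eq_clamp ?(ltW st)// et ltxx.
  have sd0 : 0 <= s0 + d by lra.
  have := orlicz_eq_lt at0 bt0 sd0 lt; rewrite et orlicz_eq_clamp//.
  by move: hit => /lt_trans h /h; rewrite ltxx.
by rewrite ltr_norml; lra.
Unshelve. all: by end_near. Qed.

Lemma orlicz_root_within (n : nat) (a b : 'rV[R]_n -> R) :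
  {within unit_sphere, continuous a} -> {within unit_sphere, continuous b} ->
  (forall u, unit_sphere u -> 0 < a u) -> (forall u, unit_sphere u -> 0 < b u) ->
  exists s : 'rV[R]_n -> R,
  [/\ {within unit_sphere, continuous s},
      forall u, unit_sphere u -> 0 < s u &
      forall u, unit_sphere u -> orlicz_eq (a u) (b u) (s u) = 1].
Proof.
move=> ca cb a0 b0.
have /choice[s sP] u : exists s, unit_sphere u ->
    0 < s /\ orlicz_eq (a u) (b u) s = 1.
  have [Su|nSu] := pselect (unit_sphere u); last by exists 0.
  by have [s s0 es] := orlicz_eq_root (a0 u Su) (b0 u Su); exists s.
exists s; split; [|by move=> u /sP[]..].
apply/subspace_continuousP => u Su; have [su eu] := sP u Su.
move/subspace_continuousP : ca => /(_ u Su) ca.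
move/subspace_continuousP : cb => /(_ u Su) cb.
apply: (orlicz_root_cvg _ (a0 u Su) (b0 u Su) su eu ca cb).
by rewrite near_withinE; apply: filterE.
Qed.

End orlicz_equation.

Section orlicz_sum.
Context {R : realType} {n : nat}.
Implicit Types (K L M : set 'rV[R]_n).

(* With [s = rho] and [a = 1 / radial K] the equation for [Phi1] functions, and
   with [s = 1 / rho] and [a = radial K] the one for [Psi1] functions, becomes
   [alpha * psi1 (s * a) + beta * psi2 (s * b) = 1] for [psi1], [psi2] in [Phi1]. *)
Lemma orlicz_radial_addP (phi1 phi2 : R -> R) (alpha beta : R) K L :
  (Phi1 phi1 /\ Phi1 phi2) \/ (Psi1 phi1 /\ Psi1 phi2) ->
  0 < alpha -> 0 < beta -> 1 <= alpha + beta -> star_body K -> star_body L ->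
  is_orlicz_radial_add (linear_orlicz alpha beta phi1 phi2) K L
    (orlicz_radial_add (linear_orlicz alpha beta phi1 phi2) K L).
Proof.
move=> phi12 a0 b0 ab1 sK sL.
(* A continuous positive solution on the sphere is the radial function of a star body, so the set
   searched by [xget] is inhabited. *)
suff [rho [crho rho0 rhoE]] : exists rho : 'rV[R]_n -> R,
  [/\ {within unit_sphere, continuous rho},
      forall u, unit_sphere u -> 0 < rho u &
      forall u, unit_sphere u -> linear_orlicz alpha beta phi1 phi2
        (rho u / radial K u) (rho u / radial L u) = 1].
  apply: (@xgetPex _ set0
    [set M | is_orlicz_radial_add (linear_orlicz alpha beta phi1 phi2) K L M]).
  exists (star_of_radial rho); split; first exact: star_body_star_of_radial.
  by move=> u Su; have [_ [_ ->]] := radial_star_of_radial rho0 Su; rewrite rhoE.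
have [_ _ cK K0] := sK; have [_ _ cL L0] := sL.
have cV (f : 'rV[R]_n -> R) : {within unit_sphere, continuous f} ->
    (forall u, unit_sphere u -> 0 < f u) ->
    {within unit_sphere, continuous (fun u => (f u)^-1)}.
  move=> /subspace_continuousP cf f0; apply/subspace_continuousP => u Su.
  by apply: cvgV; [rewrite gt_eqF// f0|exact: cf].
have V0 (f : 'rV[R]_n -> R) : (forall u, unit_sphere u -> 0 < f u) ->
    forall u, unit_sphere u -> 0 < (f u)^-1.
  by move=> f0 u Su; rewrite invr_gt0 f0.
case: phi12 => -[P1 P2].
  have [s [cs s0 sE]] := orlicz_root_within P1 P2 a0 b0 ab1
    (cV _ cK K0) (cV _ cL L0) (V0 _ K0) (V0 _ L0).
  by exists s; split.
move: P1 P2 => [_ [psi1 P1 E1]] [_ [psi2 P2 E2]].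
have [s [cs s0 sE]] := orlicz_root_within P1 P2 a0 b0 ab1 cK cL K0 L0.
exists (fun u => (s u)^-1); split; [exact: cV|exact: V0|].
move=> u Su; rewrite -(sE u Su) /linear_orlicz /orlicz_eq.
by rewrite E1 ?mulr_gt0 ?s0 ?K0// E2 ?mulr_gt0 ?s0 ?L0// !invfM.
Qed.

End orlicz_sum.

(** * Dilates and the equality case *)

Section dilates_theory.
Context {R : realType} {n : nat}.
Local Notation mu := (@lebesgue_tuple R n).
Implicit Types (K L M : set 'rV[R]_n) (x : 'rV[R]_n).

Lemma volume_const_ratio K M (k : R) : (0 < n)%N -> star_body K -> star_body M ->
  (forall x, x != 0 -> radial_ratio K M x = k) ->
  volume K / volume M = k ^+ n.
Proof.
move=> n0 sK sM hk; have vM := volume_gt0 n0 sM.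
suff -> : volume K = k ^+ n * volume M by rewrite mulfK// gt_eqF.
apply: EFin_inj; rewrite -(cone_integral n0 sK sM) EFinM -(cone_integral n0 sM sM).
rewrite -(integralZl (measurable_punctured n0 sM) (integrable_ratioX n0 sM sM)).
apply: eq_integral => t /set_mem[_ t0].
by rewrite hk// radial_ratioxx// expr1n mule1.
Qed.

Lemma dilates_of_radial K L (l : R) : (0 < n)%N -> star_body K -> star_body L ->
  0 < l -> (forall x, x != 0 -> radial L x = l * radial K x) -> dilates K L.
Proof.
move=> n0 sK sL l0 h; exists l => //.
have mem x : x != 0 -> L (l *: x) <-> K x.
  move=> x0; have lx0 : l *: x != 0 by rewrite scaler_eq0 negb_or gt_eqF.
  rewrite (star_bodyP sL lx0) (star_bodyP sK x0) radialZ// h//.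
  by rewrite mulrA mulVf ?gt_eqF// mul1r.
apply/seteqP; split => [x Lx|_ [x Kx <-]].
  have xE : l *: (l^-1 *: x) = x by rewrite scalerA divff ?gt_eqF// scale1r.
  exists (l^-1 *: x) => //; have [->|x0] := eqVneq x 0.
    by rewrite scaler0; exact: star_body0.
  by apply/mem; rewrite ?xE// scaler_eq0 negb_or x0 andbT invr_eq0 gt_eqF.
have [->|x0] := eqVneq x 0; first by rewrite scaler0; exact: star_body0.
exact/mem.
Qed.

(** Two positive numbers with the same positive lower bounds are equal; by [star_bodyP] such a bound
    [r] says that [r *: x] is in [L], or that its preimage is in [K]. *)
Lemma radial_dilates K L : star_body K -> star_body L -> dilates K L ->
  exists2 l, 0 < l & forall x, x != 0 -> radial L x = l * radial K x.
Proof.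
move=> sK sL [l l0 LE]; exists l => // x x0.
have LK r : 0 < r -> r <= radial L x <-> r <= l * radial K x.
  move=> r0; have rx0 : r *: x != 0 by rewrite scaler_eq0 negb_or gt_eqF.
  have rlx0 : (l^-1 * r) *: x != 0.
    by rewrite scaler_eq0 negb_or x0 andbT gt_eqF// mulr_gt0// invr_gt0.
  transitivity (L (r *: x)).
    by rewrite (star_bodyP sL rx0) radialZ// mulrC ler_pdivlMr// mul1r.
  transitivity (K ((l^-1 * r) *: x)).
    rewrite LE; split => [[y Ky yr]|Kr].
      by rewrite -scalerA -yr scalerA mulVf ?gt_eqF// scale1r.
    by exists ((l^-1 * r) *: x) => //; rewrite scalerA mulrA divff ?gt_eqF// mul1r.
  rewrite (star_bodyP sK rlx0) radialZ// ?mulr_gt0 ?invr_gt0//.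
  by rewrite invfM invrK mulrAC ler_pdivlMr// mul1r.
apply/eqP; rewrite eq_le; apply/andP; split.
  by apply/LK => //; exact: radial_gt0.
by apply/LK => //; rewrite mulr_gt0// radial_gt0.
Qed.

End dilates_theory.

(** * Strict monotonicity of the Orlicz functions, and passage to [root_conj] *)

Section monotonicity.
Context {R : realType}.
Implicit Types phi : R -> R.

Lemma Psi1_lt phi (s t : R) : Psi1 phi -> 0 < s -> s < t -> phi t < phi s.
Proof.
move=> [_ [psi P E]] s0 st; have t0 := lt_trans s0 st.
rewrite -[s]invrK -[t]invrK -!E ?invr_gt0//; apply: Phi1_lt => //.
  by rewrite invr_ge0 ltW.
by rewrite ltf_pV2.
Qed.

(** Both summands are strictly monotone in the same direction: increasing for [Phi1], decreasing for
    [Psi1]. *)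
Lemma orlicz_inj (phi1 phi2 : R -> R) (alpha beta l s t : R) :
  (Phi1 phi1 /\ Phi1 phi2) \/ (Psi1 phi1 /\ Psi1 phi2) ->
  0 < alpha -> 0 < beta -> 0 < l -> 0 < s -> 0 < t ->
  alpha * phi1 s + beta * phi2 (s * l) = alpha * phi1 t + beta * phi2 (t * l) ->
  s = t.
Proof.
move=> phi12 a0 b0 l0; wlog st : s t / s < t => [H s0 t0 E|s0 t0 E].
  by case: (ltgtP s t) => // st; [exact: H|apply/esym; exact: H].
have stl : s * l < t * l by rewrite ltr_pM2r.
have sl0 : 0 < s * l by rewrite mulr_gt0.
exfalso; move: E; case: phi12 => -[P1 P2]; apply/eqP.
  by rewrite lt_eqF// ltrD// ltr_pM2l//; apply: Phi1_lt => //; exact: ltW.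
by rewrite gt_eqF// ltrD// ltr_pM2l//; apply: Psi1_lt.
Qed.

Lemma orlicz_inj1 phi (s t : R) : Phi1 phi \/ Psi1 phi ->
  0 < s -> 0 < t -> phi s = phi t -> s = t.
Proof.
move=> Pphi; wlog st : s t / s < t => [H s0 t0 E|s0 t0 E].
  by case: (ltgtP s t) => // st; [exact: H|apply/esym; exact: H].
exfalso; move: E; case: Pphi => P; apply/eqP.
  by rewrite lt_eqF// Phi1_lt// ltW.
by rewrite gt_eqF// Psi1_lt.
Qed.

(** Rewrites the defining equation in terms of [n]-th powers of the ratios, the quantities whose
    integrals over the Orlicz sum are volumes. *)
Lemma root_conjX phi (n : nat) (h : R) : (0 < n)%N -> 0 < h ->
  root_conj n phi (h ^+ n) = phi h^-1.
Proof.
move=> n0 h0; rewrite /root_conj -powR_mulrn ?ltW// -powRrM mulrN divff.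
  by rewrite powR_inv1// ltW.
by rewrite pnatr_eq0 -lt0n.
Qed.

Lemma root_conj_div phi (n : nat) (v w : R) : 0 < v -> 0 < w ->
  phi ((w / v) `^ n%:R^-1) = root_conj n phi (v / w).
Proof.
move=> v0 w0; rewrite /root_conj -mulN1r powRrM powR_inv1 ?divr_ge0 ?ltW//.
by rewrite invf_div.
Qed.

End monotonicity.

(** * Dual Orlicz-Brunn-Minkowski inequality with its equality cases *)

Theorem corollary3p1 (R : realType) (n : nat) (n_gt0 : (0 < n)%N)
  (phi1 phi2 : R -> R)
  (phi12 : (Phi1 phi1 /\ Phi1 phi2) \/ (Psi1 phi1 /\ Psi1 phi2))
  (alpha beta : R) (alpha_gt0 : 0 < alpha) (beta_gt0 : 0 < beta)
  (alphabeta_ge1 : 1 <= alpha + beta)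
  (K L : set 'rV[R]_n) (starK : star_body K) (starL : star_body L) :
  let F1 := root_conj n phi1 in
  let F2 := root_conj n phi2 in
  let KL := orlicz_radial_add (linear_orlicz alpha beta phi1 phi2) K L in
  let lhs := alpha * phi1 ((volume KL / volume K) `^ n%:R^-1)
             + beta * phi2 ((volume KL / volume L) `^ n%:R^-1) in
  (convex_function (`]0, +oo[ : set R^o) F1 ->
   convex_function (`]0, +oo[ : set R^o) F2 ->
   lhs <= 1 /\
   (strictly_convex_function `]0, +oo[ F1 \/
    strictly_convex_function `]0, +oo[ F2 ->
    (lhs = 1 <-> dilates K L)))
  /\
  (concave_function `]0, +oo[ F1 ->
   concave_function `]0, +oo[ F2 ->
   1 <= lhs /\
   (strictly_concave_function `]0, +oo[ F1 \/
    strictly_concave_function `]0, +oo[ F2 ->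
    (lhs = 1 <-> dilates K L))).
Proof.
move=> F1 F2 M lhs.
have [sM addE] := orlicz_radial_addP phi12 alpha_gt0 beta_gt0 alphabeta_ge1 starK starL.
rewrite -/M in sM addE.
have vK := volume_gt0 n_gt0 starK; have vL := volume_gt0 n_gt0 starL.
have vM := volume_gt0 n_gt0 sM.
pose t1 := volume K / volume M; pose t2 := volume L / volume M.
have lhsE : lhs = alpha * F1 t1 + beta * F2 t2.
  by rewrite /lhs (root_conj_div phi1 n vK vM) (root_conj_div phi2 n vL vM).
have hK0 x (x0 : x != 0) := radial_ratio_gt0 starK sM x0.
have hL0 x (x0 : x != 0) := radial_ratio_gt0 starL sM x0.
(* The equation is given on the sphere; homogeneity of degree 0 extends it to every nonzero
   vector. *)
have phiE x : x != 0 -> alpha * phi1 (radial_ratio K M x)^-1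
    + beta * phi2 (radial_ratio L M x)^-1 = 1.
  move=> x0; have l0 : 0 < (enorm x)^-1 by rewrite invr_gt0 enorm_gt0.
  rewrite (addE _ (unit_sphere_normalize x0)) /linear_orlicz.
  by rewrite -!(radial_ratioZ _ _ x0 l0)// /radial_ratio !invf_div.
have FE x : x != 0 -> alpha * F1 (radial_ratio K M x ^+ n)
    + beta * F2 (radial_ratio L M x ^+ n) = 1.
  by move=> x0; rewrite /F1 /F2 !root_conjX ?hK0 ?hL0// phiE.
have [x1 x10] := @rowv_neq0 R n n_gt0.
(* For dilates one ratio is a fixed multiple of the other, so the equation and [orlicz_inj] make
   both constant; the volume ratios are then their [n]-th powers, and the pointwise equation is the
   claim. *)
have dil_eq : dilates K L -> alpha * F1 t1 + beta * F2 t2 = 1.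
  move=> /(radial_dilates starK starL)[l l0 rL].
  have hLE x : x != 0 -> radial_ratio L M x = l * radial_ratio K M x.
    by move=> x0; rewrite /radial_ratio rL// mulrA.
  have hKc x : x != 0 -> radial_ratio K M x = radial_ratio K M x1.
    move=> x0; apply: invr_inj.
    apply: (orlicz_inj phi12 alpha_gt0 beta_gt0 (l := l^-1));
      rewrite ?invr_gt0 ?hK0//.
    by rewrite -!invfM ![_ * l]mulrC -!hLE// !phiE.
  have hLc x : x != 0 -> radial_ratio L M x = radial_ratio L M x1.
    by move=> x0; rewrite !hLE// hKc.
  rewrite /t1 /t2 (volume_const_ratio n_gt0 starK sM hKc).
  by rewrite (volume_const_ratio n_gt0 starL sM hLc) FE.
have PK : Phi1 phi1 \/ Psi1 phi1 by case: phi12 => -[]; [left|right].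
have PL : Phi1 phi2 \/ Psi1 phi2 by case: phi12 => -[]; [left|right].
have expI (s t : R) : 0 < s -> 0 < t -> s ^+ n = t ^+ n -> s = t.
  by move=> s0 t0; apply: (pexpIrn n_gt0); rewrite nnegrE ltW.
(* Strictness of one function makes one ratio constant; the equation and injectivity of the other
   function then fix the other ratio. *)
have const_dil : (forall x, x != 0 -> radial_ratio K M x ^+ n = t1) \/
    (forall x, x != 0 -> radial_ratio L M x ^+ n = t2) -> dilates K L.
  move=> H.
  have Kc x : x != 0 -> radial_ratio K M x = radial_ratio K M x1 /\
      radial_ratio L M x = radial_ratio L M x1.
    move=> x0; have E := etrans (phiE x x0) (esym (phiE x1 x10)).
    case: H => [HK|HL].
      have hE : radial_ratio K M x = radial_ratio K M x1.
        by apply: expI; rewrite ?hK0// !HK.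
      split => //; apply: invr_inj; apply: (orlicz_inj1 PL); rewrite ?invr_gt0 ?hL0//.
      by move: E; rewrite hE => /addrI/(mulfI (lt0r_neq0 beta_gt0)).
    have hE : radial_ratio L M x = radial_ratio L M x1.
      by apply: expI; rewrite ?hL0// !HL.
    split => //; apply: invr_inj; apply: (orlicz_inj1 PK); rewrite ?invr_gt0 ?hK0//.
    by move: E; rewrite hE => /addIr/(mulfI (lt0r_neq0 alpha_gt0)).
  apply: (@dilates_of_radial _ _ _ _ (radial_ratio L M x1 / radial_ratio K M x1)) => //.
    by rewrite divr_gt0 ?hK0 ?hL0.
  move=> x x0; have [<- <-] := Kc x x0.
  have rK := radial_gt0 starK x0; have rM := radial_gt0 sM x0.
  by rewrite /radial_ratio; field; rewrite !gt_eqF.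
split => c1 c2.
  have [le1 eq1] := jensen_star_bodies n_gt0 starK starL sM alpha_gt0 beta_gt0 c1 c2 FE.
  (* The strict part of [jensen_star_bodies] concerns its first function, so the bodies are
     exchanged to treat strictness of [F2]. *)
  have FE' x : x != 0 -> beta * F2 (radial_ratio L M x ^+ n)
    + alpha * F1 (radial_ratio K M x ^+ n) = 1 by move=> x0; rewrite addrC FE.
  have [_ eq2] := jensen_star_bodies n_gt0 starL starK sM beta_gt0 alpha_gt0 c2 c1 FE'.
  rewrite lhsE; split => // sc; split => [E|]; last exact: dil_eq.
  apply: const_dil; case: sc => sc; [left; exact: eq1|right; apply: eq2 => //].
  by rewrite addrC.
(* Concavity is convexity of the negatives, for which the constant value of the sum is -1. *)
have NE x : x != 0 -> alpha * - F1 (radial_ratio K M x ^+ n)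
    + beta * - F2 (radial_ratio L M x ^+ n) = -1.
  by move=> x0; rewrite !mulrN -opprD FE.
have [le1 eq1] := jensen_star_bodies n_gt0 starK starL sM alpha_gt0 beta_gt0 c1 c2 NE.
have NE' x : x != 0 -> beta * - F2 (radial_ratio L M x ^+ n)
  + alpha * - F1 (radial_ratio K M x ^+ n) = -1 by move=> x0; rewrite addrC NE.
have [_ eq2] := jensen_star_bodies n_gt0 starL starK sM beta_gt0 alpha_gt0 c2 c1 NE'.
rewrite lhsE; split.
  by move: le1; rewrite !mulrN -opprD lerN2.
move=> sc; split => [E|]; last exact: dil_eq.
apply: const_dil; case: sc => sc; [left; apply: eq1 => //|right; apply: eq2 => //].
  by rewrite !mulrN -opprD E.
by rewrite !mulrN -opprD addrC E.
Qed.
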